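(* Let $c\ge1$ and let $G$ be a finite nilpotent group of class $t\ge2$, with upper central series terms $Z_j=Z_j(G)$. Then (i)(a) if $c+1\le t$, then $|\gamma_t(G)|\,|M^{(c)}(G)|$ divides $|M^{(c)}(G/\gamma_t(G))|\,|\otimes^{c+1}(\gamma_t(G),G/Z_{t-1}(G))|$; (i)(b) if $c+1>t$, then $|\gamma_{c+1}(G)|\,|M^{(c)}(G)|$ divides $|M^{(c)}(G/\gamma_t(G))|\,|\otimes^{c+1}(\gamma_t(G),G/Z_{t-1}(G))|$; (ii) $\exp(M^{(c)}(G))$ divides $\exp(M^{(c)}(G/\gamma_t(G)))\exp(\otimes^{c+1}(\gamma_t(G),G/Z_{t-1}(G)))$; (iii) $d(M^{(c)}(G))\le d(M^{(c)}(G/\gamma_t(G)))+d(\otimes^{c+1}(\gamma_t(G),G/Z_{t-1}(G)))$.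
   Context: $\gamma_1(X)=X$, $\gamma_{i+1}(X)=[\gamma_i(X),X]$; $Z_j(G)$ is the $j$-th term of the upper central series. For subgroups $U,V$, $[U,{}_0V]=U$, $[U,{}_{i+1}V]=[[U,{}_iV],V]$. The $c$-nilpotent multiplier of $G\cong F/R$ ($F$ free) is $M^{(c)}(G)=(R\cap\gamma_{c+1}(F))/[R,{}_cF]$, independent of the presentation. For groups $B,A$, $\otimes^{c+1}(B,A)$ denotes the tensor product over $\mathbb Z$ $B_{ab}\otimes A_{ab}\otimes\cdots\otimes A_{ab}$ with $c$ copies of $A_{ab}$, where $X_{ab}=X/X'$ (here $\gamma_t(G)$ and $G/Z_{t-1}(G)$ are already abelian). $d(X)$ is the minimal number of generators and $\exp(X)$ the exponent. *)

(* Defs.v *)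
From HB Require Import structures.
From mathcomp Require Import all_boot all_order all_algebra all_fingroup all_solvable.
From Stdlib Require Import ClassicalEpsilon.
Set Implicit Arguments. Unset Strict Implicit. Unset Printing Implicit Defensive.

Inductive gen (T : Type) (mul : T -> T -> T) (inv : T -> T) (one : T)
    (S : T -> Prop) : T -> Prop :=
  | gen_in x : S x -> gen mul inv one S x
  | gen_one : gen mul inv one S one
  | gen_mul x y : gen mul inv one S x -> gen mul inv one S y ->
                  gen mul inv one S (mul x y)
  | gen_inv x : gen mul inv one S x -> gen mul inv one S (inv x).

Definition gcomm (T : Type) (mul : T -> T -> T) (inv : T -> T) (x y : T) : T :=
  mul (mul (inv x) (inv y)) (mul x y).

Definition commS (T : Type) (mul : T -> T -> T) (inv : T -> T) (one : T)
    (U V : T -> Prop) : T -> Prop :=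
  gen mul inv one (fun z => exists x y, U x /\ V y /\ z = gcomm mul inv x y).

Fixpoint itcomm (T : Type) (mul : T -> T -> T) (inv : T -> T) (one : T)
    (U V : T -> Prop) (n : nat) : T -> Prop :=
  match n with
  | 0 => U
  | n'.+1 => commS mul inv one (itcomm mul inv one U V n') V
  end.

Definition gpow (T : Type) (mul : T -> T -> T) (one : T) (x : T) (n : nat) : T :=
  iter n (mul x) one.

(* least natural number satisfying P (classical choice; meaningful when
   such a number exists) *)
Definition least (P : nat -> Prop) : nat :=
  epsilon (inhabits 0) (fun n => P n /\ forall m, P m -> n <= m).

(* For N a normal subgroup of the subgroup A:                           *)
(* A/N has exactly n elements (n coset representatives)                *)
Definition card_sec (T : Type) (mul : T -> T -> T) (inv : T -> T)
    (A N : T -> Prop) (n : nat) : Prop :=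
  exists f : 'I_n -> T,
    (forall i, A (f i)) /\
    (forall i j, N (mul (f i) (inv (f j))) -> i = j) /\
    (forall x, A x -> exists i, N (mul x (inv (f i)))).

Definition sec_order (T : Type) (mul : T -> T -> T) (inv : T -> T)
    (A N : T -> Prop) : nat := least (card_sec mul inv A N).

Definition sec_exp (T : Type) (mul : T -> T -> T) (one : T)
    (A N : T -> Prop) : nat :=
  least (fun e => 0 < e /\ forall x, A x -> N (gpow mul one x e)).

Definition sec_d (T : Type) (mul : T -> T -> T) (inv : T -> T) (one : T)
    (A N : T -> Prop) : nat :=
  least (fun n => exists f : 'I_n -> T, (forall i, A (f i)) /\
           forall x, A x -> gen mul inv one (fun y => N y \/ exists i, y = f i) x).

(* Free group on an eqType X: reduced words, stored as stacks (the     *)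
(* word is the reverse of the stored list).  A letter (x, b) stands    *)
(* for x if b = false and x^-1 if b = true.                            *)

Definition canc (X : eqType) (a b : X * bool) : bool :=
  (a.1 == b.1) && (a.2 != b.2).

Definition reducedb (X : eqType) (s : seq (X * bool)) : bool :=
  if s is a :: s' then path (fun a b => ~~ canc a b) a s' else true.

Definition fstep (X : eqType) (st : seq (X * bool)) (a : X * bool) :=
  if st is b :: st' then (if canc a b then st' else a :: st) else [:: a].

Lemma fstep_red (X : eqType) (st : seq (X * bool)) a :
  reducedb st -> reducedb (fstep st a).
Proof.
case: st => [|b st] //= Hr.
case: ifP => Hc /=.
  by case: st Hr => [|c st] //= /andP[].
by rewrite Hc Hr.
Qed.

Lemma foldl_fstep_red (X : eqType) (s st : seq (X * bool)) :
  reducedb st -> reducedb (foldl (@fstep X) st s).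
Proof.
elim: s st => [|a s IH] st Hst //=.
by apply: IH; apply: fstep_red.
Qed.

Definition FG (X : eqType) := {s : seq (X * bool) | reducedb s}.

Definition fg_push (X : eqType) (u : FG X) (s : seq (X * bool)) : FG X :=
  exist _ (foldl (@fstep X) (proj1_sig u) s)
          (foldl_fstep_red s (proj2_sig u)).

Definition fg_one (X : eqType) : FG X := exist _ [::] isT.

Definition fg_mul (X : eqType) (u v : FG X) : FG X :=
  fg_push u (rev (proj1_sig v)).

Definition fg_inv (X : eqType) (u : FG X) : FG X :=
  fg_push (fg_one X) (map (fun a => (a.1, ~~ a.2)) (proj1_sig u)).

(* The c-nilpotent multiplier of a finite group G, computed from the   *)
(* free presentation F/R, F free on the elements of G, F -> G the      *)
(* canonical epimorphism:  M^(c)(G) = (R /\ gamma_{c+1}(F)) / [R,_c F] *)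

Section Mult.
Local Open Scope group_scope.

Definition genG (gT : finGroupType) (G : {group gT}) : eqType :=
  {x : gT | x \in G}.

Definition fg_eval (gT : finGroupType) (G : {group gT}) (u : FG (genG G)) : gT :=
  foldr (fun (a : genG G * bool) acc =>
           (if a.2 then (val a.1)^-1 else val a.1) * acc) 1 (rev (proj1_sig u)).

Definition presR (gT : finGroupType) (G : {group gT}) : FG (genG G) -> Prop :=
  fun w => fg_eval w = 1.
Arguments presR {gT} G w.

Definition multA (c : nat) (gT : finGroupType) (G : {group gT}) : FG (genG G) -> Prop :=
  fun w => presR G w /\
    itcomm (@fg_mul _) (@fg_inv _) (fg_one _) (fun _ => True) (fun _ => True) c w.
Arguments multA c {gT} G w.

Definition multN (c : nat) (gT : finGroupType) (G : {group gT}) : FG (genG G) -> Prop :=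
  itcomm (@fg_mul _) (@fg_inv _) (fg_one _) (presR G) (fun _ => True) c.
Arguments multN c {gT} G _.

Definition mult_order c (gT : finGroupType) (G : {group gT}) : nat :=
  sec_order (@fg_mul _) (@fg_inv _) (multA c G) (multN c G).
Definition mult_exp c (gT : finGroupType) (G : {group gT}) : nat :=
  sec_exp (@fg_mul _) (fg_one _) (multA c G) (multN c G).
Definition mult_d c (gT : finGroupType) (G : {group gT}) : nat :=
  sec_d (@fg_mul _) (@fg_inv _) (fg_one _) (multA c G) (multN c G).

End Mult.

(* Tensor product  H1 (x) H2 (x) ... (x) H2  (c copies of H2) over Z    *)
(* of finite abelian groups, as the free abelian group Z^(H1 x H2^c)   *)
(* (functions on the finite type T1 * T2^c, with the coordinates       *)
(* outside H1 x H2^c killed) modulo the multilinearity relations.      *)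

Section Tensor.
Local Open Scope ring_scope.

Definition tidx (T1 T2 : finType) (c : nat) : finType :=
  (T1 * {ffun 'I_c -> T2})%type.

Definition fadd (P : Type) (f g : P -> int) : P -> int := fun q => f q + g q.
Definition fopp (P : Type) (f : P -> int) : P -> int := fun q => - f q.
Definition fzero (P : Type) : P -> int := fun _ => 0.
Definition delta (P : eqType) (p : P) : P -> int :=
  fun q => if q == p then 1 else 0.

Definition fupd (T2 : finType) (c : nat) (bs : {ffun 'I_c -> T2}) (i : 'I_c) (v : T2) :
  {ffun 'I_c -> T2} := [ffun j => if j == i then v else bs j].

Definition tensor_rels (gT1 gT2 : finGroupType) (H1 : {set gT1}) (H2 : {set gT2})
    (c : nat) (r : tidx gT1 gT2 c -> int) : Prop :=
  (exists p : tidx gT1 gT2 c,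
      (p.1 \notin H1 \/ exists i, p.2 i \notin H2) /\ r = delta p)
  \/ (exists (a a' : gT1) (bs : {ffun 'I_c -> gT2}),
      [/\ a \in H1, a' \in H1, (forall i, bs i \in H2) &
       r = fadd (delta ((a * a')%g, bs))
                (fopp (fadd (delta (a, bs)) (delta (a', bs))))])
  \/ (exists (a : gT1) (bs : {ffun 'I_c -> gT2}) (i : 'I_c) (b' : gT2),
      [/\ a \in H1, (forall j, bs j \in H2), b' \in H2 &
       r = fadd (delta (a, fupd bs i (bs i * b')%g))
                (fopp (fadd (delta (a, bs)) (delta (a, fupd bs i b'))))]).

Arguments tensor_rels {gT1 gT2} H1 H2 c r.

Definition tensorK (gT1 gT2 : finGroupType) (H1 : {set gT1}) (H2 : {set gT2})
    (c : nat) : (tidx gT1 gT2 c -> int) -> Prop :=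
  gen (@fadd _) (@fopp _) (@fzero _) (tensor_rels H1 H2 c).

Arguments tensorK {gT1 gT2} H1 H2 c _.

(* (x)^{c+1}(B, A) = B_ab (x) A_ab (x) ... (x) A_ab  (c copies of A_ab) *)
Definition tensK (gT1 gT2 : finGroupType) (B : {group gT1}) (A : {group gT2}) (c : nat) :=
  tensorK (B / B^`(1))%g (A / A^`(1))%g c.

Arguments tensK {gT1 gT2} B A c _.

Definition tens_order (gT1 gT2 : finGroupType) (B : {group gT1}) (A : {group gT2}) c : nat :=
  sec_order (@fadd _) (@fopp _) (fun _ => True) (tensK B A c).
Definition tens_exp (gT1 gT2 : finGroupType) (B : {group gT1}) (A : {group gT2}) c : nat :=
  sec_exp (@fadd _) (@fzero _) (fun _ => True) (tensK B A c).
Definition tens_d (gT1 gT2 : finGroupType) (B : {group gT1}) (A : {group gT2}) c : nat :=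
  sec_d (@fadd _) (@fopp _) (@fzero _) (fun _ => True) (tensK B A c).

End Tensor.

(* Main.v *)
Require Import Defs.
From HB Require Import structures.
From mathcomp Require Import all_boot all_order all_algebra all_fingroup all_solvable.
From mathcomp Require Import boolp ring.
Set Implicit Arguments. Unset Strict Implicit. Unset Printing Implicit Defensive.

Local Open Scope group_scope.

(* Write G = F/R with F free, S/R = L_t(G), and X_i = [X, _i F].  Since L_t(G) is
   central, S_c lies in R n gamma_{c+1}(F), so (S n gamma_{c+1})/R_c is filtered in
   two ways: through S_c, with factors M(G/L_t) and S_c/R_c, and through
   R n gamma_{c+1}, with factors L_t(G) n L_{c+1}(G) and M(G).  It remains to see
   that S_c/R_c is a quotient of the tensor product: [S_i, F] lies in R_i, so S_i/R_i
   is central in F/R_i and the commutator S_i/R_i x F -> S_{i+1}/R_{i+1} is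
   bilinear; it kills the preimage of Z_{t-1}(G) by the three subgroups lemma,
   as S_i lies in gamma_{t+i}(F) R_i.  Finiteness of the multipliers follows from
   the same filtration by induction on the class, for every group F mapping onto G. *)

(** * Commutator subgroups *)

(** The multiplier of G/L_t(G) is defined through the free group on the elements of that quotient,
    whereas the filtration yields (S n gamma_{c+1}(F))/S_c with F free on the elements of G.
    Freeness gives homomorphisms both ways between the two free groups, but they are mutually
    inverse only modulo the relation subgroups. What saves the comparison is that an endomorphism
    which is the identity modulo R is the identity modulo R_c on gamma_{c+1}(F); this rests on the
    inclusion of [gamma_k(F), N] in [N, _k F] for N normal, the same form of the three subgroups
    lemma that kills Z_{t-1}(G). For the number of generators a quotient is not enough: (R n
    gamma_{c+1}(F))/S_c is a subgroup of (S n gamma_{c+1}(F))/S_c, and it needs no more generators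
    because the latter is abelian. *)

Notation ggen := (gen *%g (@inv _) 1).
Notation gcommS := (commS *%g (@inv _) 1).
Notation gitcomm := (itcomm *%g (@inv _) 1).
Notation gfull := (fun _ => True).
(* The index is shifted: [glcn n] is gamma_{n+1}. *)
Notation glcn n := (gitcomm gfull gfull n).

Definition subgroup (F : groupType) (A : F -> Prop) : Prop :=
  [/\ A 1, forall x y, A x -> A y -> A (x * y) & forall x, A x -> A x^-1].

Definition normal_subgroup (F : groupType) (A : F -> Prop) : Prop :=
  subgroup A /\ forall x y, A x -> A (x ^ y).

Section Subgroups.
Variable F : groupType.
Implicit Types (A B N U V : F -> Prop) (x y z : F).

Lemma sub_div A x y : subgroup A -> A x -> A y -> A (x * y^-1).
Proof. by case=> _ AM AV Ax Ay; apply: AM => //; apply: AV. Qed.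

Lemma sub_mull A x y : subgroup A -> A x -> A (x * y) -> A y.
Proof. by case=> _ AM AV Ax /(AM _ _ (AV _ Ax)); rewrite mulKg. Qed.

Lemma sub_mulr A x y : subgroup A -> A y -> A (x * y) -> A x.
Proof. by case=> _ AM AV Ay /AM/(_ (AV _ Ay)); rewrite mulgK. Qed.

Lemma sub_expg A x n : subgroup A -> A x -> A (x ^+ n).
Proof.
by case=> A1 AM _ Ax; elim: n => [|n IHn]; rewrite ?expg0 // expgS; apply: AM.
Qed.

Lemma normal_invC N x y : normal_subgroup N -> N (x * y) -> N (y * x).
Proof. by case=> _ NJ /(NJ _ x); rewrite conjgE !mulgA mulVg mul1g. Qed.

Lemma full_normal : normal_subgroup (fun _ : F => True).
Proof. by []. Qed.

Lemma subgroup_normal N : normal_subgroup N -> subgroup N.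
Proof. by case. Qed.

Lemma subI A B : subgroup A -> subgroup B -> subgroup (fun x => A x /\ B x).
Proof.
case=> A1 AM AV [B1 BM BV]; split=> [|x y [Ax Bx] [Ay By]|x [Ax Bx]] //.
  by split; [apply: AM|apply: BM].
by split; [apply: AV|apply: BV].
Qed.

Lemma gen_subgroup U : subgroup (ggen U).
Proof.
split; [exact: gen_one|exact: gen_mul|exact: gen_inv].
Qed.

Lemma gen_min U A x : subgroup A -> (forall x, U x -> A x) -> ggen U x -> A x.
Proof.
case=> A1 AM AV sUA; elim=> {x}[x /sUA //||x y _ Ax _ Ay|x _ Ax] //.
- exact: AM.
- exact: AV.
Qed.

Lemma gen_normal U :
  (forall x y, U x -> U (x ^ y)) -> normal_subgroup (ggen U).
Proof.
move=> UJ; split=> [|x y]; first exact: gen_subgroup.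
elim=> {x}[x Ux||x z _ IHx _ IHz|x _ IHx]; rewrite ?conj1g ?conjMg ?conjVg.
- exact/gen_in/UJ.
- exact: gen_one.
- exact: gen_mul.
- exact: gen_inv.
Qed.

Lemma gcommE x y : gcomm *%g (@inv F) x y = [~ x, y].
Proof. by rewrite /gcomm -mulgA. Qed.

Lemma commS_mem U V x y : U x -> V y -> gcommS U V [~ x, y].
Proof. by move=> Ux Vy; apply: gen_in; exists x, y; rewrite gcommE. Qed.

Lemma commS_min U V A z : subgroup A ->
  (forall x y, U x -> V y -> A [~ x, y]) -> gcommS U V z -> A z.
Proof.
move=> sA UVA; apply: gen_min => // w [x [y [Ux [Vy ->]]]].
by rewrite gcommE; apply: UVA.
Qed.

Lemma commS_normal U V : normal_subgroup U -> normal_subgroup V -> normal_subgroup (gcommS U V).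
Proof.
case=> _ UJ [_ VJ]; apply: gen_normal => _ w [x [y [Ux [Vy ->]]]].
exists (x ^ w), (y ^ w); split; first exact: UJ.
by split; [exact: VJ|rewrite !gcommE conjRg].
Qed.

Lemma itcomm_normal U V n : normal_subgroup U -> normal_subgroup V -> normal_subgroup (gitcomm U V n).
Proof. by move=> nU nV; elim: n => //= n IHn; apply: commS_normal. Qed.

Lemma glcn_normal n : normal_subgroup (glcn n : F -> Prop).
Proof. exact: itcomm_normal. Qed.

Lemma itcommD U V m n : gitcomm U V (m + n) = gitcomm (gitcomm U V m) V n.
Proof. by elim: n => [|n IHn]; rewrite ?addn0 // addnS /= IHn. Qed.

Lemma itcommS U V n : gitcomm U V n.+1 = gitcomm (gcommS U V) V n.
Proof. by rewrite -addn1 addnC itcommD. Qed.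

Lemma commS_sub U U' V x :
  (forall x, U x -> U' x) -> gcommS U V x -> gcommS U' V x.
Proof.
move=> sU; apply: commS_min => [|y z Uy Vz]; first exact: gen_subgroup.
by apply: commS_mem => //; apply: sU.
Qed.

Lemma itcomm_sub U U' V n x :
  (forall x, U x -> U' x) -> gitcomm U V n x -> gitcomm U' V n x.
Proof. by move=> sU; elim: n x => [|n IHn] x /=; [exact: sU|apply: commS_sub]. Qed.

Lemma normal_comm N x y : normal_subgroup N -> N x -> N [~ x, y].
Proof. by move=> [sN NJ] Nx; rewrite commgEl; case: (sN) => _ NM NV; apply: NM; [apply: NV|apply: NJ]. Qed.

Lemma itcommS_sub N n x : normal_subgroup N -> gitcomm N gfull n.+1 x -> gitcomm N gfull n x.
Proof.
move=> nN /=; have nI := itcomm_normal n nN full_normal.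
by apply: commS_min => [|y z Iy _]; [case: nI|apply: normal_comm].
Qed.

Lemma itcomm_subD N n m x : normal_subgroup N -> gitcomm N gfull (n + m) x -> gitcomm N gfull n x.
Proof.
move=> nN; elim: m => [|m IHm]; rewrite ?addn0 // addnS => /itcommS_sub IS.
exact/IHm/IS.
Qed.

Lemma Hall_Witt x y z :
  [~ x, y^-1, z] ^ y * [~ y, z^-1, x] ^ z * [~ z, x^-1, y] ^ x = 1.
Proof.
(* Each factor is a quotient of two values of [a] at cyclically shifted arguments, so the product
   telescopes. *)
pose a x y z : F := x * z * y ^ x.
suffices{x y z} hw x y z: [~ x, y^-1, z] ^ y = (a x y z)^-1 * (a y z x).
  by rewrite !hw; move: a {hw} => a; rewrite 2!mulgA !mulgK mulVg.
by rewrite /a !commgEl !conjgE ?invgM ?invgK ?invgM ?invgK !mulgA ?(mulgK, mulgVK, mulVg, mul1g).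
Qed.

Lemma commg_mull x y z : [~ x * y, z] = [~ x, z] ^ y * [~ y, z].
Proof. by rewrite !commgEr conjgM mulgA -conjMg mulgK. Qed.

Lemma commg_mulr x y z : [~ x, y * z] = [~ x, z] * [~ x, y] ^ z.
Proof. by rewrite !commgEl conjgM -mulgA -conjMg mulVKg. Qed.

Lemma commg_invl x y : [~ x^-1, y] = ([~ x, y]^-1) ^ x^-1.
Proof.
by apply: (mulgI ([~ x, y] ^ x^-1)); rewrite -commg_mull mulgV comm1g -conjMg mulgV conj1g.
Qed.

(* By the three subgroups lemma: [[g_n,F],N] lies in [[N,F],g_n] [[N,g_n],F]. *)
Lemma comm_lcn N n x y :
  normal_subgroup N -> glcn n x -> N y -> gitcomm N gfull n.+1 [~ x, y].
Proof.
elim: n N x y => [|n IHn] N x y nN.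
  move=> _ Ny; have [[_ _ NV] _] := commS_normal nN full_normal.
  by rewrite -[[~ x, y]]invgK invgR; apply: NV; apply: commS_mem.
have nNn k := itcomm_normal k nN full_normal.
have nW := nNn n.+2; set W := gitcomm N gfull n.+2 in nW *.
have [[W1 WM WV] WJ] := nW.
pose P u := forall v, N v -> W [~ u, v].
suff: subgroup P /\ forall u w, glcn n u -> P [~ u, w].
  by case=> sP PR lx Ny; apply: (commS_min sP _ lx _ Ny) => u w lu _; apply: PR.
split; first split=> [v _|u w Pu Pw v Nv|u Pu v Nv].
- by rewrite comm1g.
- by rewrite commg_mull; apply: WM; [apply/WJ/Pu|apply: Pw].
- by rewrite commg_invl; apply/WJ/WV/Pu.
have nlN : normal_subgroup (glcn n : F -> Prop) := glcn_normal n.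
move=> u w lu v Nv; rewrite -[w]invgK.
have Wcyc x1 x2 x3 : W x2 -> W x3 -> x1 * x2 * x3 = 1 -> W x1.
  move=> W2 W3 e1; apply: (sub_mulr (subgroup_normal nW) W2).
  by apply: (sub_mulr (subgroup_normal nW) W3); rewrite e1.
have Hw := Hall_Witt u w^-1 v.
suff /(WJ _ w) : W ([~ u, w^-1^-1, v] ^ w^-1) by rewrite conjgKV.
apply: Wcyc Hw; apply: WJ.
  (* The factor [w^-1, v^-1, u]: the induction hypothesis is applied to [N, F] in place of N, whence
     the generality in N. The remaining factor [v, u^-1, w^-1] uses it for N itself. *)
  rewrite -[[~ _, u]]invgK invgR; apply: WV; rewrite /W itcommS.
  apply: IHn => //; first exact: commS_normal.
  have [_ _ CV] := subgroup_normal (nNn 1%N).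
  by rewrite -[[~ _, _]]invgK invgR; apply: CV; apply: commS_mem => //; case: nN => -[_ _ NV] _; apply: NV.
apply: commS_mem => //.
have [[_ _ nV] _] := nNn n.+1; rewrite -[[~ _, _]]invgK invgR; apply: nV.
by apply: IHn => //; case: nlN => -[_ _ lV] _; apply: lV.
Qed.

End Subgroups.

(** * Quotient groups *)

Record nsub (F : groupType) := Nsub {nsub_pred :> F -> Prop; nsubP : normal_subgroup nsub_pred}.

Section Quotient.
Variables (F : groupType) (N : nsub F).
Implicit Types x y z : F.

(** [choose] returns the same element for equivalent predicates, so this is a canonical coset
    representative, and the quotient can be the subtype of its fixed points. *)
Definition qrepr x : F := choose (fun y => `[< N (x * y^-1) >]) x.

Lemma qrepr_eq x y : N (x * y^-1) <-> qrepr x = qrepr y.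
Proof.
have [[[N1 NM NV] NJ] P] := (nsubP N, fun z => @chooseP F (fun y => `[< N (z * y^-1) >]) z).
have {}P z : N (z * (qrepr z)^-1) by apply/asboolP/P/asboolP; rewrite mulgV.
split=> [Nxy|e]; last first.
  by move: (NM _ _ (P x) (NV _ (P y))); rewrite e invgM invgK mulgA mulgVK.
rewrite /qrepr; have eP : (fun z => `[< N (x * z^-1) >]) =1 (fun z => `[< N (y * z^-1) >]).
  move=> z; apply/asbool_equiv_eq; split=> Nz.
    by move: (NM _ _ (NV _ Nxy) Nz); rewrite invgM invgK mulgA mulgVK.
  by move: (NM _ _ Nxy Nz); rewrite mulgA mulgVK.
rewrite (eq_choose eP); apply: choose_id; apply/asboolP; last by rewrite mulgV.
by move: (NV _ Nxy); rewrite invgM invgK.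
Qed.

Lemma qrepr_id x : qrepr (qrepr x) == qrepr x.
Proof.
apply/eqP/esym/qrepr_eq.
by apply/asboolP/(@chooseP F (fun y => `[< N (x * y^-1) >])); apply/asboolP; rewrite mulgV; case: (nsubP N) => -[].
Qed.

Definition quot := {x : F | qrepr x == x}.
HB.instance Definition _ := Choice.on quot.

Definition qpi x : quot := exist _ (qrepr x) (qrepr_id x).

Lemma qpi_eq x y : qpi x = qpi y <-> N (x * y^-1).
Proof.
split=> [[/qrepr_eq] //|/qrepr_eq e].
by apply: val_inj.
Qed.

Lemma qpi_val (u : quot) : qpi (val u) = u.
Proof. by apply: val_inj; apply/eqP; case: u. Qed.

Let qmul (u v : quot) := qpi (val u * val v).
Let qinv (u : quot) := qpi (val u)^-1.

Let qpiM x y : qpi (x * y) = qmul (qpi x) (qpi y).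
Proof.
have [[N1 NM NV] NJ] := nsubP N.
have [ex ey] : N (x * (val (qpi x))^-1) /\ N (y * (val (qpi y))^-1).
  by split; apply/qpi_eq; rewrite qpi_val.
apply/qpi_eq; rewrite invgM -!mulgA (mulgA y) -[x in x * _](mulgVK (val (qpi x))).
move: ex ey; set a := _ * _^-1; set b := _ * _^-1 => Na Nb.
rewrite -mulgA; apply: NM => //.
by have := NJ _ (val (qpi x))^-1 Nb; rewrite conjgE invgK !mulgA.
Qed.

Let qpiV x : qpi x^-1 = qinv (qpi x).
Proof.
have [[N1 NM NV] NJ] := nsubP N.
have ex : N (val (qpi x) * x^-1) by apply/qpi_eq; rewrite qpi_val.
by apply/qpi_eq; rewrite invgK; apply: (normal_invC (nsubP N)).
Qed.

Let qmulA : associative qmul.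
Proof.
by move=> u v w; rewrite -(qpi_val u) -(qpi_val v) -(qpi_val w) -!qpiM mulgA.
Qed.
Let qmul1g : left_id (qpi 1) qmul.
Proof. by move=> u; rewrite -(qpi_val u) -qpiM mul1g. Qed.
Let qmulg1 : right_id (qpi 1) qmul.
Proof. by move=> u; rewrite -(qpi_val u) -qpiM mulg1. Qed.
Let qmulVg : left_inverse (qpi 1) qinv qmul.
Proof. by move=> u; rewrite -(qpi_val u) -qpiV -qpiM mulVg. Qed.
Let qmulgV : right_inverse (qpi 1) qinv qmul.
Proof. by move=> u; rewrite -(qpi_val u) -qpiV -qpiM mulgV. Qed.

HB.instance Definition _ := isGroup.Build quot qmulA qmul1g qmulg1 qmulVg qmulgV.

Let qpiF : {morph qpi : x y / x * y^-1}.
Proof. by move=> x y; rewrite qpiM qpiV. Qed.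

HB.instance Definition _ := isGroupMorphism.Build F quot qpi qpiF.

Lemma qpi_eq1 x : qpi x = 1 <-> N x.
Proof. by rewrite (_ : 1 = qpi 1) ?gmulf1 // qpi_eq invg1 mulg1. Qed.

End Quotient.
Arguments qpi {F} N x.

(** * Iterated commutators modulo [R, _i F] *)

(** The left-normed commutator [s, g_1, ..., g_k], which will be the image of a pure tensor. *)
Definition mcomm (F : groupType) (s : F) (gs : seq F) : F := foldl (@commg F) s gs.

Section CentralSteps.
Variables (F : groupType) (R S Z : F -> Prop).
Hypotheses (nR : normal_subgroup R) (nS : normal_subgroup S).
Hypothesis RS : forall x, R x -> S x.
Hypothesis SF : forall x y, S x -> R [~ x, y].
Notation Rn i := (gitcomm R gfull i).
Notation Sn i := (gitcomm S gfull i).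
Implicit Types x y z g : F.

Definition Rsub i : nsub F := Nsub (itcomm_normal i nR (full_normal F)).

(** [S_i, F] is also [[S, F], _i F], so the case i = 0, which is [SF], gives all the others. *)
Lemma itcomm_central i x g : Sn i x -> Rn i [~ x, g].
Proof.
move=> Sx; apply: (@itcomm_sub _ (gcommS S gfull)).
  by move=> y; apply: commS_min => [|u v Su _]; [case: nR|apply: SF].
by rewrite -itcommS; apply: commS_mem.
Qed.

Lemma itcomm_RS i x : Rn i x -> Sn i x.
Proof. exact: itcomm_sub. Qed.

Lemma qpi_central i x g : Sn i x -> qpi (Rsub i) (x ^ g) = qpi (Rsub i) x.
Proof.
move=> Sx; apply/qpi_eq.
have [[_ RM RV] RJ] := nsubP (Rsub i).
have -> : x ^ g * x^-1 = [~ x, g] ^ x^-1 by rewrite commgEl !conjgE invgK !mulgA mulgV mul1g.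
by apply: RJ; apply: itcomm_central.
Qed.

Lemma qpi_commM i x y g : Sn i x -> Sn i y ->
  qpi (Rsub i.+1) [~ x * y, g] = qpi (Rsub i.+1) [~ x, g] * qpi (Rsub i.+1) [~ y, g].
Proof.
move=> Sx Sy; rewrite commg_mull gmulfM /= qpi_central //.
exact: commS_mem.
Qed.

Lemma qpi_commMr i x g h : Sn i x ->
  qpi (Rsub i.+1) [~ x, g * h] = qpi (Rsub i.+1) [~ x, g] * qpi (Rsub i.+1) [~ x, h].
Proof.
move=> Sx; have SR g' : Sn i.+1 [~ x, g'] by apply: commS_mem.
rewrite commg_mulr gmulfM /= qpi_central // -!gmulfM /=.
rewrite (commgC [~ x, g]) [RHS]gmulfM /= [X in _ = _ * X](_ : _ = 1) ?mulg1 //.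
by apply/qpi_eq1; apply: itcomm_central.
Qed.

Lemma mcomm_mem i s gs : Sn i s -> Sn (i + size gs) (mcomm s gs).
Proof.
elim: gs i s => [|g gs IHgs] i s Ss; rewrite ?addn0 //= -addSnnS.
by apply: IHgs; apply: commS_mem.
Qed.

(** The product is assumed only modulo R_i because, after one commutator, [z, g] agrees with
    [x, g][y, g] only modulo R_{i+1}; in this form the statement passes along the list. *)
Lemma qpi_mcommM i x y z gs : Sn i x -> Sn i y ->
  qpi (Rsub i) z = qpi (Rsub i) x * qpi (Rsub i) y ->
  qpi (Rsub (i + size gs)) (mcomm z gs) =
    qpi (Rsub (i + size gs)) (mcomm x gs) * qpi (Rsub (i + size gs)) (mcomm y gs).
Proof.
elim: gs i x y z => [|g gs IHgs] i x y z Sx Sy; rewrite ?addn0 //= -addSnnS => ez.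
apply: IHgs; try exact: commS_mem.
have [r Rr ->] : exists2 r, Rn i r & z = r * (x * y).
  by exists (z * (x * y)^-1); rewrite ?mulgVK //; move: ez; rewrite -gmulfM => /qpi_eq.
have Sxy : Sn i (x * y) by have [[_ SM _] _] := itcomm_normal i nS (full_normal F); apply: SM.
rewrite qpi_commM //; last exact: itcomm_RS.
rewrite [X in X * _](_ : _ = 1) ?mul1g ?qpi_commM //.
by apply/qpi_eq1; apply: commS_mem.
Qed.

Hypothesis SZ : forall i x z, Sn i x -> Z z -> Rn i.+1 [~ x, z].

(** Linearity in the slot [j0]. Slots before it merely move the base point from S_i to S_{i+1}; at
    [j0] the error lies in Z and is killed by [SZ]; from there on linearity in the first argument
    takes over. *)
Lemma qpi_mcommMr (J : eqType) (js : seq J) (j0 : J) (h h1 h2 : J -> F) i x :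
  Sn i x -> uniq js -> j0 \in js ->
  (forall j, j != j0 -> h1 j = h j /\ h2 j = h j) ->
  Z (h j0 * (h1 j0 * h2 j0)^-1) ->
  qpi (Rsub (i + size js)) (mcomm x (map h js)) =
    qpi (Rsub (i + size js)) (mcomm x (map h1 js)) *
    qpi (Rsub (i + size js)) (mcomm x (map h2 js)).
Proof.
move=> Sx + + hj Zj; elim: js i x Sx => [//|j js IHjs] i x Sx /= /andP[jNjs ujs].
have SR g : Sn i.+1 [~ x, g] by apply: commS_mem.
rewrite inE -addSnnS; case: (eqVneq j j0) => [ej _|/hj[-> ->]]; last first.
  by move=> /= jjs; apply: IHjs.
have eh k : k \in js -> h1 k = h k /\ h2 k = h k.
  by move=> kjs; apply: hj; apply: contraNneq jNjs => ek; rewrite ej -ek.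
have e1 : map h1 js = map h js by apply/eq_in_map => k /eh[].
have e2 : map h2 js = map h js by apply/eq_in_map => k /eh[].
have -> : size js = size (map h js) by rewrite size_map.
rewrite e1 e2; apply: qpi_mcommM => //; rewrite ej.
set z := h j0 * _ in Zj.
rewrite -qpi_commMr // -[h j0](mulgVK (h1 j0 * h2 j0)) -/z qpi_commMr //.
by rewrite [X in X * _](_ : _ = 1) ?mul1g //; apply/qpi_eq1; apply: SZ.
Qed.

(** Pure commutators of representatives span S_i modulo R_i: replacing the last entry by its
    representative costs an element of Z, which commutes with S_i modulo R_{i+1}. *)
Lemma mcomm_gen (T1 T2 : Type) (H1 : T1 -> Prop) (H2 : T2 -> Prop)
    (l1 : T1 -> F) (l2 : T2 -> F) :
  (forall a, H1 a -> S (l1 a)) ->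
  (forall s, S s -> exists2 a, H1 a & R (s * (l1 a)^-1)) ->
  (forall g, exists2 b, H2 b & Z (g * (l2 b)^-1)) ->
  forall i x, Sn i x ->
    ggen (fun y => Rn i y \/ exists a (bs : i.-tuple T2),
                  [/\ H1 a, forall j, H2 (tnth bs j) & y = mcomm (l1 a) (map l2 bs)]) x.
Proof.
move=> Sl1 l1P l2P; elim=> [|i IHi] x.
  move=> Sx; have [a Ha Rxa] := l1P x Sx; rewrite -[x](mulgVK (l1 a)).
  apply: gen_mul; first by apply: gen_in; left.
  apply: gen_in; right; exists a, [tuple]; split=> // -[] //.
set W := ggen _; have [W1 WM WV] : subgroup W by apply: gen_subgroup.
have RW y : Rn i.+1 y -> W y by move=> Ry; apply: gen_in; left.
have SWJ y g : Sn i.+1 y -> W y -> W (y ^ g).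
  move=> Sy Wy; have -> : y ^ g = y * [~ y, g] by rewrite commgEl mulVKg.
  by apply: WM => //; apply: RW; apply: itcomm_central.
(* The elements whose commutators with all of F lie in W form a subgroup, since W absorbs
   conjugation of elements of S_{i+1} up to R_{i+1}. Hence it is enough to test generators of
   S_i. *)
pose P y := Sn i y /\ forall g, W [~ y, g].
have [[S1 SM SV] SJ] := itcomm_normal i nS (full_normal F).
have SR y g : Sn i y -> Sn i.+1 [~ y, g] by move=> Sy; apply: commS_mem.
have sP : subgroup P.
  split; first by split=> // g; rewrite comm1g.
    move=> y z [Sy Wy] [Sz Wz]; split=> [|g]; first exact: SM.
    by rewrite commg_mull; apply: WM => //; apply: SWJ => //; apply: SR.
  move=> y [Sy Wy]; split=> [|g]; first exact: SV.
  rewrite commg_invl; apply: SWJ; last exact: WV.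
  by have [[_ _ SV'] _] := itcomm_normal i.+1 nS (full_normal F); apply: SV'; apply: SR.
apply: commS_min => [//|y g Sy _]; apply: (proj2 _ g); move: (IHi y Sy).
apply: (gen_min sP) => {Sy}{}y [Ry|[a [bs [Ha Hb ->]]]].
  by have Sy := itcomm_RS Ry; split=> // g'; apply: RW; apply: commS_mem.
set m := mcomm _ _; have Sm : Sn i m.
  by have := @mcomm_mem 0 (l1 a) (map l2 bs) (Sl1 a Ha); rewrite size_map size_tuple.
split=> // g'; have [b Hb' Zb] := l2P g'; rewrite -[g'](mulgVK (l2 b)) commg_mulr.
apply: WM; last first.
  by apply: SWJ; [apply: SR|apply: RW; apply: SZ].
apply: gen_in; right; exists a, [tuple of rcons bs b]; split=> // [j|].
  rewrite (tnth_nth b) /= nth_rcons size_tuple; case: ltnP => [lt|].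
    by have := Hb (Ordinal lt); rewrite (tnth_nth b).
  by case: ifP.
by rewrite /= map_rcons -cats1 /mcomm foldl_cat.
Qed.

End CentralSteps.

(** * Finite sections *)

Notation gcard_sec := (card_sec *%g (@inv _)).
Notation gsec_order := (sec_order *%g (@inv _)).
Notation gsec_exp := (sec_exp *%g 1).
Notation gsec_d := (sec_d *%g (@inv _) 1).

(** [least] is an epsilon term about which nothing is known until some number satisfies [P]; this is
    why every section must be shown finite before its order, exponent or rank is compared with
    anything. *)
Lemma leastP (P : nat -> Prop) n : P n -> P (least P) /\ forall m, P m -> least P <= m.
Proof.
move=> Pn; apply: (ClassicalEpsilon.epsilon_spec (inhabits 0)
  (fun n => P n /\ forall m, P m -> n <= m)).
have exP : exists n, `[< P n >] by exists n; apply/asboolP.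
exists (ex_minn exP); case: ex_minnP => m /asboolP Pm mP; split=> // k Pk.
by apply/mP/asboolP.
Qed.

Section Sections.
Variable F : groupType.
Implicit Types (A B N : F -> Prop) (x y z : F).

Lemma coset_sym N x y : subgroup N -> N (x * y^-1) -> N (y * x^-1).
Proof. by case=> _ _ NV /NV; rewrite invgM invgK. Qed.

Lemma coset_trans N x y z : subgroup N -> N (x * y^-1) -> N (y * z^-1) -> N (x * z^-1).
Proof. by case=> _ NM _ Nxy Nyz; have := NM _ _ Nxy Nyz; rewrite mulgA mulgVK. Qed.

Lemma card_sec_fin (I : finType) A N (f : I -> F) :
  (forall i, A (f i)) -> (forall i j, N (f i * (f j)^-1) -> i = j) ->
  (forall x, A x -> exists i, N (x * (f i)^-1)) -> gcard_sec A N #|I|.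
Proof.
move=> Af fI fS; exists (fun i => f (enum_val i)); split=> [i|]; first exact: Af.
split=> [i j /fI/enum_val_inj //|x /fS[i Ni]].
by exists (enum_rank i); rewrite enum_rankK.
Qed.

Lemma card_sec_leq A N m n : subgroup N -> gcard_sec A N m -> gcard_sec A N n -> m <= n.
Proof.
move=> sN [f [Af [fI _]]] [g [_ [_ gS]]].
have [h hP] := choice (fun i => gS _ (Af i)).
have hI : injective h.
  move=> i j e; apply: fI; apply: (coset_trans sN (hP i)).
  by rewrite e; apply: coset_sym.
by have := leq_card h hI; rewrite !card_ord.
Qed.

Lemma card_sec_uniq A N m n : subgroup N -> gcard_sec A N m -> gcard_sec A N n -> m = n.
Proof. by move=> sN cm cn; apply/eqP; rewrite eqn_leq (card_sec_leq sN cm cn) (card_sec_leq sN cn cm). Qed.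

Lemma sec_orderE A N n : subgroup N -> gcard_sec A N n -> gsec_order A N = n.
Proof.
move=> sN cn; have [cl _] := leastP cn; exact: card_sec_uniq cl cn.
Qed.

Lemma card_secM A B N m n : subgroup A -> subgroup B ->
  (forall x, B x -> A x) -> (forall x, N x -> B x) ->
  gcard_sec A B m -> gcard_sec B N n -> gcard_sec A N (m * n)%N.
Proof.
move=> sA sB BA NB [f [Af [fI fS]]] [g [Bg [gI gS]]].
have -> : (m * n)%N = #|{: 'I_m * 'I_n}| by rewrite card_prod !card_ord.
apply: (@card_sec_fin _ _ _ (fun ij => g ij.2 * f ij.1)).
- by move=> [i j] /=; case: (sA) => _ AM _; apply: AM; [apply: BA|].
- move=> [i j] [i' j'] /=; rewrite invgM => Ngf.
  have ei : i = i'.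
    apply: fI; have [_ BM BV] := sB; have := NB _ Ngf.
    by rewrite -!mulgA => /(sub_mull sB (Bg _)); rewrite mulgA => /(sub_mulr sB (BV _ (Bg _))).
  by move: Ngf; rewrite ei !mulgA mulgK => /gI->.
- move=> x /[dup] Ax /fS[i Bxi]; have [j Nj] := gS _ Bxi.
  by exists (i, j); rewrite /= invgM mulgA.
Qed.

(** Cosets are counted by a complete invariant [k] with finitely many values. It serves both for the
    map to G and for coverings by finitely many cosets. *)
Lemma card_sec_inv (I : finType) A N (k : F -> I) :
  (forall x y, A x -> A y -> N (x * y^-1) <-> k x = k y) ->
  gcard_sec A N #|[set i | `[< exists2 x, A x & k x = i >]]|.
Proof.
move=> kP; set K := [set i | _]; pose KT := {i : I | i \in K}.
have rP (i : KT) : exists x, A x /\ k x = val i.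
  by case: i => i /=; rewrite inE => /asboolP[x]; exists x.
have [r rE] := choice rP.
have -> : #|K| = #|{: KT}| by rewrite card_sig.
apply: (card_sec_fin (f := r)) => [i|i j|x Ax].
- by case: (rE i).
- have [Ai ei] := rE i; have [Aj ej] := rE j.
  by move/(kP _ _ Ai Aj); rewrite ei ej => /val_inj.
have kxK : k x \in K by rewrite inE; apply/asboolP; exists x.
exists (exist _ (k x) kxK); have [Ar er] := rE (exist _ (k x) kxK).
by apply/kP.
Qed.

(** The cosets N (f i) may overlap and the [f i] may lie outside [A]; the set of all indices whose
    coset contains x is still a complete invariant of the coset of x. *)
Lemma card_sec_cover (I : finType) A N (f : I -> F) : subgroup N ->
  (forall x, A x -> exists i, N (x * (f i)^-1)) -> exists n, gcard_sec A N n.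
Proof.
move=> sN fS; exists #|[set s | `[< exists2 x, A x & [set i | `[< N (x * (f i)^-1) >]] = s >]]|.
apply: card_sec_inv => x y Ax Ay; split=> [Nxy|e].
  apply/setP=> i; rewrite !inE; apply/asbool_equiv_eq; split.
    by apply: coset_trans => //; apply: coset_sym.
  exact: coset_trans.
have [i Ni] := fS x Ax; move/setP/(_ i): e; rewrite !inE asboolT // => /esym/asboolP.
by move/(coset_sym sN); apply: coset_trans.
Qed.

Lemma card_sec_sub A A' N N' n : subgroup N' ->
  (forall x, A' x -> A x) -> (forall x, N x -> N' x) ->
  gcard_sec A N n -> exists n', gcard_sec A' N' n'.
Proof.
move=> sN' AA NN [f [_ [_ fS]]]; apply: (@card_sec_cover _ _ _ f) => // x /AA/fS[i].
by move/NN; exists i.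
Qed.

Lemma gpowE x n : gpow *%g 1 x n = x ^+ n.
Proof. by elim: n => //= n IHn; rewrite expgS -IHn. Qed.

(** Pigeonhole replaces Lagrange, as [N] is just a subgroup: two of the powers x^0, ..., x^n share a
    coset, so x^k lies in [N] for some 0 < k <= n, and k divides n!. *)
Lemma card_sec_exp A N n x : subgroup A -> subgroup N ->
  gcard_sec A N n -> A x -> N (x ^+ n`!).
Proof.
move=> sA sN [f [_ [_ fS]]] Ax.
have [h hP] := choice (fun i : 'I_n.+1 => fS _ (sub_expg i sA Ax)).
have : ~~ injectiveb h.
  by apply/negP => /injectiveP/leq_card; rewrite !card_ord ltnn.
case/injectivePn => i [j ij hij].
have Nij : N (x ^+ i * (x ^+ j)^-1).
  by apply: (coset_trans sN (hP i)); rewrite hij; apply: coset_sym.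
have [k [kle k0 Nk]] : exists k, [/\ k <= n, 0 < k & N (x ^+ k)].
  case: (ltngtP i j) => [lt|lt|/val_inj e]; last by rewrite e eqxx in ij.
    exists (j - i)%N; rewrite subn_gt0 lt; split=> //.
      by apply: leq_trans (leq_subr _ _) _; rewrite -ltnS.
    by rewrite expgnFr 1?ltnW //; apply: coset_sym.
  exists (i - j)%N; rewrite subn_gt0 lt; split=> //.
    by apply: leq_trans (leq_subr _ _) _; rewrite -ltnS.
  by rewrite expgnFr 1?ltnW.
have /dvdnP[q ->] : k %| n`! by rewrite dvdn_fact // k0.
by rewrite mulnC expgnA; apply: sub_expg.
Qed.

Lemma sec_exp_spec A N n : subgroup A -> subgroup N -> gcard_sec A N n ->
  [/\ 0 < gsec_exp A N, forall x, A x -> N (x ^+ gsec_exp A N) &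
    forall e, 0 < e -> (forall x, A x -> N (x ^+ e)) -> gsec_exp A N <= e].
Proof.
move=> sA sN cn; pose P e := 0 < e /\ forall x, A x -> N (gpow *%g 1 x e).
have Pn : P n`!.
  by split=> [|y Ay]; rewrite ?fact_gt0 // gpowE; apply: card_sec_exp cn Ay.
have [[m0 mP] mmin] := leastP Pn; split=> // [x Ax|e e0 eP].
  by rewrite -gpowE; apply: mP.
by apply: mmin; split=> // x Ax; rewrite gpowE; apply: eP.
Qed.

Lemma sec_expP A N n : subgroup A -> subgroup N -> gcard_sec A N n ->
  forall x, A x -> N (x ^+ gsec_exp A N).
Proof. by move=> sA sN cn; case: (sec_exp_spec sA sN cn). Qed.

Lemma sec_exp_dvd A N n e : subgroup A -> subgroup N -> gcard_sec A N n ->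
  (forall x, A x -> N (x ^+ e)) -> gsec_exp A N %| e.
Proof.
move=> sA sN cn eP; have [m0 mP mmin] := sec_exp_spec sA sN cn.
move: (gsec_exp A N) m0 mP mmin => m m0 mP mmin; rewrite /dvdn; case: posnP => // r0.
suff /(mmin _ r0) : forall x, A x -> N (x ^+ (e %% m)) by rewrite leqNgt ltn_mod m0.
move=> x Ax; have := eP _ Ax; rewrite {1}(divn_eq e m) expgnDr mulnC expgnA.
by apply: sub_mull => //; apply: sub_expg => //; apply: mP.
Qed.

Definition gen_by A N n :=
  exists f : 'I_n -> F, (forall i, A (f i)) /\
    forall x, A x -> ggen (fun y => N y \/ exists i, y = f i) x.

Lemma sec_d_genP A N n : gcard_sec A N n -> gen_by A N (gsec_d A N).
Proof.
move=> [f [Af [_ fS]]].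
suff P : gen_by A N n by have [] := leastP (P := gen_by A N) P.
exists f; split=> // x /fS[i Ni]; rewrite -[x](mulgVK (f i)).
by apply: gen_mul; apply: gen_in; [left|right; exists i].
Qed.

Lemma sec_d_le A N n : gen_by A N n -> gsec_d A N <= n.
Proof. by move=> P; have [_] := leastP (P := gen_by A N) P; apply. Qed.

End Sections.

(** [phi] has to respect cosets rather than products, so that it can be a mere choice of coset
    representatives. *)
Lemma card_sec_map (F F' : groupType) (phi : F -> F') (A N : F -> Prop) (A' N' : F' -> Prop) n :
  subgroup N' ->
  (forall x, A x -> A' (phi x)) ->
  (forall x y, A x -> A y -> N (x * y^-1) <-> N' (phi x * (phi y)^-1)) ->
  (forall y, A' y -> exists2 x, A x & N' (y * (phi x)^-1)) ->
  gcard_sec A N n -> gcard_sec A' N' n.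
Proof.
move=> sN' phiA phiN phiS [f [Af [fI fS]]]; exists (phi \o f); split=> [i|] /=.
  exact: phiA.
split=> [i j /phiN/fI->//|y /phiS[x Ax Nyx]].
have [i /phiN Ni] := fS x Ax; exists i; apply: (coset_trans sN' Nyx).
exact: Ni.
Qed.

(** * Numbers of generators of sections *)

Section Generation.
Variable F : groupType.
Implicit Types (A B L N U : F -> Prop) (x y z : F).

Lemma gen_byD A L N m n :
  (forall x, L x -> A x) -> gen_by A L m -> gen_by L N n -> gen_by A N (m + n).
Proof.
move=> LA [f [Af fP]] [g [Lg gP]].
pose h (i : 'I_(m + n)) := match split i with inl j => f j | inr j => g j end.
have hl j : h (lshift n j) = f j by rewrite /h (unsplitK (inl j)).
have hr j : h (rshift m j) = g j by rewrite /h (unsplitK (inr j)).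
exists h; split=> [i|x /fP].
  by rewrite /h; case: (split i) => j //; apply: LA.
apply: gen_min => [|y [/gP|[j ->]]]; first exact: gen_subgroup.
  apply: gen_min => [|z [Nz|[j ->]]]; first exact: gen_subgroup.
    by apply: gen_in; left.
  by apply: gen_in; right; exists (rshift m j).
by apply: gen_in; right; exists (lshift n j).
Qed.

Section AbelianSection.
Variables (A U : F -> Prop).
Hypotheses (sA : subgroup A) (sU : subgroup U).
Hypothesis AU : forall x y, A x -> A y -> U [~ x, y].

Lemma cosetJ x y : A x -> A y -> U x -> U (x ^ y).
Proof.
move=> Ax Ay Ux; have -> : x ^ y = x * [~ x, y] by rewrite commgEl mulVKg.
by have [_ UM _] := sU; apply: UM => //; apply: AU.
Qed.

Lemma cosetM x x' y y' : A x -> A x' -> A y -> A y' ->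
  U (x * y^-1) -> U (x' * y'^-1) -> U (x * x' * (y * y')^-1).
Proof.
move=> Ax Ax' Ay Ay' Uxy Uxy'; have [_ UM _] := sU; have [_ AM AV] := sA.
have -> : x * x' * (y * y')^-1 = (x' * y'^-1) ^ x^-1 * (x * y^-1).
  by rewrite conjgE invgK invgM !mulgA mulgVK.
apply: UM => //; apply: cosetJ => //; last exact: AV.
by apply: AM => //; apply: AV.
Qed.

Lemma cosetX x y n : A x -> A y -> U (x * y^-1) -> U (x ^+ n * (y ^+ n)^-1).
Proof.
move=> Ax Ay Uxy; elim: n => [|n IHn]; first by rewrite !expg0 mulgV; case: sU.
by rewrite !expgS; apply: cosetM => //; apply: sub_expg.
Qed.

Lemma cosetV x y : A x -> A y -> U (x * y^-1) -> U (x^-1 * y^-1^-1).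
Proof.
move=> Ax Ay /(coset_sym sU) Uyx; have [_ AM AV] := sA; rewrite invgK.
have -> : x^-1 * y = (y * x^-1) ^ x by rewrite conjgE !mulgA mulgVK.
by apply: cosetJ => //; apply: AM => //; apply: AV.
Qed.

End AbelianSection.

(* The exponents k with a^k in B modulo the span of the other generators form an
   ideal of the integers, and its generator m yields one new generator of B; as
   A/N is finite, natural exponents suffice. *)
Lemma gen_by_sub n A B N q :
  subgroup A -> subgroup B -> subgroup N -> gcard_sec A N q ->
  (forall x y, A x -> A y -> N [~ x, y]) ->
  (forall x, B x -> A x) -> (forall x, N x -> B x) ->
  gen_by A N n -> gen_by B N n.
Proof.
move=> + + sN; elim: n A B q => [|n IHn] A B q sA sB cA AN BA NB [f [Af fP]].
  exists f; split=> [[]//|x /BA/fP]; apply: gen_min => [|y [Ny|[[]//]]].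
    exact: gen_subgroup.
  by apply: gen_in; left.
have [[A1 AM AV] [_ BM BV]] := (sA, sB).
pose U := ggen (fun y => N y \/ exists i : 'I_n, y = f (lift ord0 i)).
have sU : subgroup U by apply: gen_subgroup.
have [U1 UM UV] := sU.
have NU x : N x -> U x by move=> Nx; apply: gen_in; left.
have UA x : U x -> A x.
  by apply: gen_min => // y [/NB/BA//|[i ->]].
have AU x y : A x -> A y -> U [~ x, y] by move=> Ax Ay; apply/NU/AN.
have [r cU] := card_sec_sub sN UA (fun x Nx => Nx) cA.
have genU : gen_by U N n.
  by exists (fun i => f (lift ord0 i)); split=> // i; apply: gen_in; right; exists i.
have sBU := subI sB sU.
(* [U] is generated modulo [N] by one element fewer, so the induction applies to [U] and its
   subgroup formed by the intersection of [B] and [U]. *)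
have [g [BUg gP]] : gen_by (fun x => B x /\ U x) N n.
  apply: (IHn U _ r) => // [x y Ux Uy|x []|x Nx] //; last by split; auto.
  by apply: AN; apply: UA.
pose a := f ord0; have Aa : A a by apply: Af.
have AaX k : A (a ^+ k) by apply: sub_expg.
have Ua : U (a ^+ q`!) by apply: NU; apply: card_sec_exp cA Aa.
have span x : A x -> exists k, U (x * (a ^+ k)^-1).
  move=> /fP; pose P y := A y /\ exists k, U (y * (a ^+ k)^-1).
  suff: forall y, ggen (fun y => N y \/ exists i, y = f i) y -> P y by move=> H /H[].
  move=> y; apply: gen_min => {y} [|y [Ny|[i ->]]]; last 2 first.
  - by split; [apply/BA/NB|exists 0%N; rewrite expg0 invg1 mulg1; apply: NU].
  - split=> //; case: (unliftP ord0 i) => [j|] ->; last first.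
      by exists 1%N; rewrite expg1 mulgV.
    by exists 0%N; rewrite expg0 invg1 mulg1; apply: gen_in; right; exists j.
  split; first by split=> //; exists 0%N; rewrite expg0 invg1 mulg1.
    move=> y z [Ay [k Uk]] [Az [l Ul]]; split; first exact: AM.
    by exists (k + l)%N; rewrite expgnDr; apply: (cosetM sA).
  move=> y [Ay [k Uk]]; split; first exact: AV.
  (* As a^(q!) lies in [U], the inverse of a^k is a^(k(q! - 1)) modulo [U], which keeps exponents
     natural. *)
  exists (k * q`!.-1)%N; apply: (coset_trans sU (cosetV sA sU AU Ay (AaX k) Uk)).
  rewrite -invgM -expgnDr; apply: UV.
  by rewrite addnC -mulnS prednK ?fact_gt0 // mulnC expgnA; apply: sub_expg.
pose I k := 0 < k /\ exists2 b, B b & U (b * (a ^+ k)^-1).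
have exI : exists k, `[< I k >].
  exists q`!; apply/asboolP; split; first exact: fact_gt0.
  by exists 1; [case: sB|rewrite mul1g; apply: UV].
case: (ex_minnP exI) => m /asboolP[m0 [b Bb Ub]] mmin.
pose h i := if unlift ord0 i is Some j then g j else b.
exists h; split=> [i|x Bx].
  by rewrite /h; case: unlift => // j; case: (BUg j).
have [k Uk] := span x (BA x Bx).
have Ab : A b by apply: BA.
have Ur : U (x * (b ^+ (k %/ m))^-1 * (a ^+ (k %% m))^-1).
  have /(cosetX sA sU AU (k %/ m) Ab (AaX m)) := Ub.
  rewrite -expgnA => /(cosetV sA sU AU (sub_expg _ sA Ab) (AaX _)) Ubk.
  have := cosetM sA sU AU (BA x Bx) (AV _ (sub_expg (k %/ m) sA Ab)) (AaX k) (AV _ (AaX _)) Uk Ubk.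
  by rewrite {2}(divn_eq k m) [(_ + k %% m)%N]addnC mulnC expgnDr mulgK.
have r0 : k %% m = 0%N.
  case: (posnP (k %% m)) => // r0; have := ltn_pmod k m0; rewrite ltnNge mmin //.
  apply/asboolP; split=> //; exists (x * (b ^+ (k %/ m))^-1) => //.
  by apply: BM => //; apply: BV; apply: sub_expg.
rewrite r0 expg0 invg1 mulg1 in Ur.
set W := ggen _; have sW : subgroup W by apply: gen_subgroup.
rewrite -[x](mulgVK (b ^+ (k %/ m))); apply: gen_mul; last first.
  apply: (sub_expg _ sW); apply: gen_in; right; exists ord0.
  by rewrite /h unlift_none.
have BUx : B (x * (b ^+ (k %/ m))^-1) /\ U (x * (b ^+ (k %/ m))^-1).
  by split=> //; apply: BM => //; apply: BV; apply: sub_expg.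
move: (gP _ BUx); apply: (gen_min sW) => y [Ny|[j ->]]; apply: gen_in; first by left.
by right; exists (lift ord0 j); rewrite /h liftK.
Qed.

End Generation.

(** * Tensor products *)

Section IntFunctions.
Variable P : finType.
(** An alias carrying pointwise addition as a multiplicative [groupType] structure, so that the
    results on sections apply to the tensor product. *)
Definition zfun := P -> int.
Implicit Types f g : zfun.

HB.instance Definition _ := Choice.copy zfun (P -> int).

Let faddA : associative (@fadd P).
Proof. by move=> f g h; apply/funext => q; apply: GRing.addrA. Qed.
Let fadd0 : left_id (@fzero P) (@fadd P).
Proof. by move=> f; apply/funext => q; apply: GRing.add0r. Qed.
Let faddr0 : right_id (@fzero P) (@fadd P).
Proof. by move=> f; apply/funext => q; apply: GRing.addr0. Qed.
Let faddN : left_inverse (@fzero P) (@fopp P) (@fadd P).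
Proof. by move=> f; apply/funext => q; apply: GRing.addNr. Qed.
Let faddrN : right_inverse (@fzero P) (@fopp P) (@fadd P).
Proof. by move=> f; apply/funext => q; apply: GRing.addrN. Qed.

HB.instance Definition _ := isGroup.Build zfun faddA fadd0 faddr0 faddN faddrN.

Lemma zfunM f g q : (f * g) q = (f q + g q)%R. Proof. by []. Qed.
Lemma zfunV f q : f^-1 q = (- f q)%R. Proof. by []. Qed.

Lemma subgroup_scale (K : zfun -> Prop) (z : int) f :
  subgroup K -> K f -> K (fun q => z * f q)%R.
Proof.
move=> sK Kf; have KX n : K (fun q => n%:Z * f q)%R.
  have -> : (fun q => n%:Z * f q)%R = f ^+ n; last exact: sub_expg.
  elim: n => [|n IHn]; first by apply/funext => q; rewrite GRing.mul0r.
  rewrite expgS -IHn; apply/funext => q; rewrite zfunM.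
  by rewrite -addn1 PoszD GRing.mulrDl GRing.mul1r GRing.addrC.
case: z => n; first exact: KX.
have [_ _ KV] := sK; have -> : (fun q => Negz n * f q)%R = ((fun q => n.+1%:Z * f q)%R : zfun)^-1.
  by apply/funext => q; rewrite NegzE GRing.mulNr.
exact/KV/KX.
Qed.

Lemma subgroup_sum_delta (K : zfun -> Prop) (m : int) :
  subgroup K -> (forall p, K (fun q => m * delta p q)%R) ->
  forall f, K (fun q => m * f q)%R.
Proof.
move=> sK Kd f; suff: K (fun q => \sum_p f p * (m * delta p q))%R.
  congr K; apply/funext => q; rewrite (bigD1 q) //= big1 ?GRing.addr0.
    by rewrite /delta eqxx GRing.mulr1 GRing.mulrC.
  by move=> p pq; rewrite /delta eq_sym (negPf pq) !GRing.mulr0.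
elim: (index_enum P) => [|p s IHs].
  by case: sK => K1 _ _; move: K1; congr K; apply/funext => q; rewrite big_nil.
have [_ KM _] := sK; have := KM _ _ (subgroup_scale (f p) sK (Kd p)) IHs.
by congr K; apply/funext => q; rewrite big_cons.
Qed.

End IntFunctions.

Section TensorFinite.
Variables (gT1 gT2 : finGroupType) (H1 : {group gT1}) (H2 : {set gT2}) (c : nat).
Notation P := (tidx gT1 gT2 c).
Notation K := (@tensorK gT1 gT2 H1 H2 c : zfun P -> Prop).

Lemma tensorK_subgroup : subgroup K.
Proof. exact: (@gen_subgroup (zfun P)). Qed.

(** Indices outside H1 x H2^c are relations themselves. Otherwise k(a (x) b) = a^k (x) b, and k =
    |H1| gives 1 (x) b, which vanishes by the relation with a = a' = 1. *)
Lemma tensorK_delta p : K (fun q => #|H1|%:Z * delta p q)%R.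
Proof.
have sK := tensorK_subgroup; have [_ KM KV] := sK.
case: p => a bs; have [inH|/negP out] := boolP ((a \in H1) && [forall i, bs i \in H2]); last first.
  apply: (subgroup_scale _ sK); apply: gen_in; left; exists (a, bs); split=> //=.
  case: (boolP (a \in H1)) => aH; [right|by left].
  have /forallPn[i bi] : ~~ [forall i, bs i \in H2] by apply/negP => h; apply: out; rewrite aH.
  by exists i.
have [aH /forallP bH] := andP inH.
have K1 : K (delta (1, bs) : zfun P).
  have := KV _ (gen_in _ _ _ (or_intror (or_introl (ex_intro _ 1 (ex_intro _ 1 (ex_intro _ bs
    (And4 (group1 H1) (group1 H1) bH erefl))))))).
  congr K; apply/funext => q.
  by rewrite zfunV mulg1 /fadd /fopp; ring.
have KX k : K (fun q => k%:Z * delta (a, bs) q - delta ((a ^+ k)%g, bs) q)%R.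
  elim: k => [|k IHk].
    have := KV _ K1; congr K; apply/funext => q.
    by rewrite zfunV GRing.mul0r GRing.sub0r.
  have Kr : K (fadd (delta (a * a ^+ k, bs)) (fopp (fadd (delta (a, bs)) (delta (a ^+ k, bs))))).
    by apply: gen_in; right; left; exists a, (a ^+ k), bs; split=> //; apply: groupX.
  have := KM _ _ IHk (KV _ Kr); congr K; apply/funext => q.
  by rewrite zfunM zfunV expgS -addn1 PoszD /fadd /fopp; ring.
have := KM _ _ (KX #|H1|) K1; congr K; apply/funext => q.
by rewrite zfunM expg_cardG // GRing.subrK.
Qed.

(** Reducing all coordinates modulo |H1| leaves finitely many functions. *)
Lemma tensor_finite : exists n, gcard_sec (fun _ : zfun P => True) K n.
Proof.
have sK := tensorK_subgroup.
pose f (i : {ffun P -> 'I_#|H1|}) : zfun P := fun q => Posz (i q).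
apply: (@card_sec_cover _ {ffun P -> 'I_#|H1|} _ _ f) => // x _.
have m0 : (Posz #|H1| != 0)%R by rewrite -lt0n cardG_gt0.
have lt q : (absz (modz (x q) (Posz #|H1|)) < #|H1|)%N.
  by rewrite -ltz_nat gez0_abs ?modz_ge0 // ltz_mod.
exists [ffun q => Ordinal (lt q)].
have := subgroup_sum_delta sK tensorK_delta (fun q => divz (x q) (Posz #|H1|)).
congr K; apply/funext => q; rewrite zfunM zfunV /f ffunE /=.
by rewrite gez0_abs ?modz_ge0 // {2}(divz_eq (x q) (Posz #|H1|)) GRing.addrK GRing.mulrC.
Qed.

End TensorFinite.

(** * Homomorphisms from Z^P to a group *)

Section IntegerPowers.
Variable E : groupType.
Implicit Types x y : E.

Definition expgz x (z : int) : E :=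
  match z with Posz n => x ^+ n | Negz n => x ^- n.+1 end.

Lemma expgz_succ x z : expgz x (z + 1)%R = expgz x z * x.
Proof.
case: z => [n|[|n]].
- by rewrite -PoszD addn1 /= expgSr.
- by rewrite /= expg0 expg1 mulVg.
- have -> : (Negz n.+1 + 1)%R = Negz n by rewrite !NegzE -addn1 PoszD; ring.
  by rewrite /= [in RHS]expgS invgM mulgVK.
Qed.

Lemma expgzD x a b : expgz x (a + b)%R = expgz x a * expgz x b.
Proof.
elim/int_rect: b => [|n IHn|n IHn]; first by rewrite GRing.addr0 /= expg0 mulg1.
  by rewrite -addn1 PoszD GRing.addrA !expgz_succ IHn mulgA.
apply: (mulIg x); rewrite -mulgA -!expgz_succ.
have e : (- n.+1%:Z + 1 = - n%:Z)%R by rewrite -addn1 PoszD; ring.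
by rewrite -GRing.addrA e.
Qed.

Lemma commute_expgz x y z : commute x y -> commute x (expgz y z).
Proof. by move=> cxy; case: z => n /=; [|apply: commuteV]; apply: commuteX. Qed.

End IntegerPowers.

Section ZfunHom.
Variables (E : groupType) (P : finType) (m : P -> E).
Hypothesis mC : forall p q, commute (m p) (m q).

(** The universal property of Z^P. The target will be F/R_c, which need not be abelian, so
    commutation is asked only of the values of [m]. *)
Definition zfun_hom (f : zfun P) : E := \prod_(p <- enum P) expgz (m p) (f p).

Lemma zfun_homM f g : zfun_hom (f * g) = zfun_hom f * zfun_hom g.
Proof.
rewrite /zfun_hom -prodgM_commute => [|p q _ _].
  by apply: eq_bigr => p _; rewrite zfunM expgzD.
by apply: commute_expgz; apply/commute_sym/commute_expgz.
Qed.

Lemma zfun_hom1 : zfun_hom 1 = 1.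
Proof. by rewrite /zfun_hom big1. Qed.

Lemma zfun_homV f : zfun_hom f^-1 = (zfun_hom f)^-1.
Proof.
by apply: (mulgI (zfun_hom f)); rewrite -zfun_homM !mulgV zfun_hom1.
Qed.

Lemma zfun_hom_delta p : zfun_hom (delta p) = m p.
Proof.
rewrite /zfun_hom; have : p \in enum P by rewrite mem_enum.
have := enum_uniq P; elim: (enum P) => // q s IHs /= /andP[qs us].
rewrite inE big_cons /delta; case: eqVneq => [-> _|nq /= ps].
  rewrite big1_seq => [|r /= rs]; first by rewrite mulg1 ?eqxx /= expg1.
  by case: eqVneq qs => // <-; rewrite rs.
by rewrite /= expg0 mul1g; apply: IHs.
Qed.

Lemma zfun_hom_subgroup (W : E -> Prop) f :
  subgroup W -> (forall p, W (m p)) -> W (zfun_hom f).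
Proof.
move=> sW Wm; rewrite /zfun_hom; elim: (enum P) => [|p s IHs]; rewrite ?big_nil ?big_cons.
  by case: sW.
have [_ WM WV] := sW; apply: WM => //.
by case: (f p) => n; [|apply: WV]; apply: (sub_expg _ sW).
Qed.

End ZfunHom.

(** * The epimorphism from the tensor product onto S_c/R_c *)

Section TensorMap.
Variables (F : groupType) (R S Z : F -> Prop).
Hypotheses (nR : normal_subgroup R) (nS : normal_subgroup S).
Hypothesis RS : forall x, R x -> S x.
Hypothesis SF : forall x y, S x -> R [~ x, y].
Hypothesis SZ : forall i x z, gitcomm S gfull i x -> Z z -> gitcomm R gfull i.+1 [~ x, z].
Variables (gT1 gT2 : finGroupType) (H1 : {group gT1}) (H2 : {group gT2}) (c : nat).
Variables (l1 : gT1 -> F) (l2 : gT2 -> F).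
Hypothesis l1S : forall a, a \in H1 -> S (l1 a).
Hypothesis l1M : forall a b, a \in H1 -> b \in H1 -> R (l1 (a * b) * (l1 a * l1 b)^-1).
Hypothesis l1P : forall s, S s -> exists2 a, a \in H1 & R (s * (l1 a)^-1).
Hypothesis l2M : forall a b, a \in H2 -> b \in H2 -> Z (l2 (a * b) * (l2 a * l2 b)^-1).
Hypothesis l2P : forall g, exists2 b, b \in H2 & Z (g * (l2 b)^-1).
Notation P := (tidx gT1 gT2 c).
Notation K := (@tensorK gT1 gT2 H1 H2 c : zfun P -> Prop).
Notation Rn i := (gitcomm R gfull i).
Notation Sn i := (gitcomm S gfull i).
Notation E := (quot (Rsub nR c)).
Notation pi := (qpi (Rsub nR c)).

(** The value 1 at the other indices matches the relations that kill them. *)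
Definition tmono (p : P) : F :=
  if (p.1 \in H1) && [forall i, p.2 i \in H2]
  then mcomm (l1 p.1) [seq l2 (p.2 j) | j <- enum 'I_c] else 1.

Definition tmap : zfun P -> E := zfun_hom (fun p => pi (tmono p)).

Lemma tmono_mem p : Sn c (tmono p).
Proof.
have [[S1 _ _] _] := itcomm_normal c nS (full_normal F).
rewrite /tmono; case: ifP => // /andP[aH _].
by have := @mcomm_mem _ S 0 _ (map (fun j => l2 (p.2 j)) (enum 'I_c)) (l1S aH); rewrite size_map size_enum_ord.
Qed.

Lemma tmono_commute p q : commute (pi (tmono p)) (pi (tmono q)).
Proof.
apply/commgP/eqP; rewrite -gmulfR; apply/qpi_eq1.
by apply: (itcomm_central nR SF); apply: tmono_mem.
Qed.

Lemma tmapM f g : tmap (f * g) = tmap f * tmap g.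
Proof. by apply: zfun_homM; apply: tmono_commute. Qed.

Lemma tmapV f : tmap f^-1 = (tmap f)^-1.
Proof. by apply: zfun_homV; apply: tmono_commute. Qed.

Lemma tmap_delta p : tmap (delta p) = pi (tmono p).
Proof. exact: zfun_hom_delta. Qed.

Lemma tmap_mem f : exists2 y, Sn c y & tmap f = pi y.
Proof.
apply: (zfun_hom_subgroup (W := fun u => exists2 y, Sn c y & u = pi y)).
  have [[S1 SM SV] _] := itcomm_normal c nS (full_normal F).
  split=> [|_ _ [y Sy ->] [z Sz ->]|_ [y Sy ->]].
  - by exists 1; rewrite ?gmulf1.
  - by exists (y * z); rewrite ?gmulfM //; apply: SM.
  - by exists y^-1; rewrite ?gmulfV //; apply: SV.
by move=> p; exists (tmono p) => //; apply: tmono_mem.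
Qed.

(** The three families of relations are met respectively by the default value of [tmono], by
    linearity in the first entry ([qpi_mcommM] with [l1M]), and by linearity in the i-th of the
    other entries ([qpi_mcommMr] with [l2M]). *)
Lemma tmap_ker f : K f -> tmap f = 1.
Proof.
have sk : subgroup (fun f : zfun P => tmap f = 1).
  split=> [|g h eg eh|g eg]; first exact: zfun_hom1.
    by rewrite tmapM eg eh mulg1.
  by rewrite tmapV eg invg1.
apply: (gen_min sk) => {f} f [[p [out ->]]|[[a [a' [bs [aH a'H bH ->]]]]|]].
- rewrite tmap_delta /tmono ifF ?gmulf1 //; apply/negP => /andP[pH /forallP bH].
  by case: out => [|[i]]; rewrite ?pH // bH.
- rewrite -[fadd _ _]/((delta (a * a', bs) : zfun P) * ((delta (a, bs) : zfun P) * (delta (a', bs) : zfun P))^-1).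
  rewrite tmapM tmapV tmapM !tmap_delta; apply/eqP; rewrite mulg_eq1 invgK; apply/eqP.
  have fb : [forall i, bs i \in H2] by apply/forallP.
  rewrite /tmono /= groupM // aH a'H fb /=.
  have := @qpi_mcommM _ _ _ nR nS RS SF 0 _ _ _ [seq l2 (bs j) | j <- enum 'I_c] (l1S aH) (l1S a'H).
  rewrite size_map size_enum_ord; apply.
  by rewrite -gmulfM; apply/qpi_eq; apply: l1M.
move=> [a [bs [i [b' [aH bH b'H ->]]]]].
rewrite -[fadd _ _]/((delta (a, fupd bs i (bs i * b')) : zfun P) * ((delta (a, bs) : zfun P) * (delta (a, fupd bs i b') : zfun P))^-1).
rewrite tmapM tmapV tmapM !tmap_delta; apply/eqP; rewrite mulg_eq1 invgK; apply/eqP.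
have fb : [forall i, bs i \in H2] by apply/forallP.
have fu b : b \in H2 -> [forall j, fupd bs i b j \in H2].
  by move=> bH2; apply/forallP => j; rewrite ffunE; case: ifP.
rewrite /tmono /= aH fb !fu ?groupM //=.
have := @qpi_mcommMr _ _ _ _ nR nS RS SF SZ _ (enum 'I_c) i
  (fun j => l2 (fupd bs i (bs i * b') j)) (fun j => l2 (bs j)) (fun j => l2 (fupd bs i b' j)) 0 _ (l1S aH).
rewrite size_enum_ord; apply; rewrite ?enum_uniq ?mem_enum //.
  by move=> j nj; rewrite !ffunE (negPf nj).
by rewrite !ffunE eqxx; apply: l2M.
Qed.

Lemma tmap_onto x : Sn c x -> exists f, pi x = tmap f.
Proof.
have si : subgroup (fun x => exists f, pi x = tmap f).
  split=> [|y z [f ef] [g eg]|y [f ef]].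
  - by exists 1; rewrite gmulf1 [RHS]zfun_hom1.
  - by exists (f * g); rewrite gmulfM /= ef eg tmapM.
  - by exists f^-1; rewrite gmulfV /= ef tmapV.
move=> /(mcomm_gen nR nS RS SF SZ l1S l1P l2P); apply: (gen_min si) => y [Ry|].
  by exists 1; rewrite [RHS]zfun_hom1; apply/qpi_eq1.
move=> [a [bs [aH bH ->]]]; exists (delta (a, [ffun i => tnth bs i])).
rewrite tmap_delta /tmono /= aH /= ifT; last by apply/forallP => i; rewrite ffunE.
congr (pi (mcomm _ _)); rewrite -[in LHS](map_tnth_enum bs) -map_comp.
by apply: eq_map => j; rewrite /= ffunE.
Qed.

Let sK := tensorK_subgroup H1 H2 c.
Let sT : subgroup (fun _ : zfun P => True). Proof. by []. Qed.
Let sRn := subgroup_normal (itcomm_normal c nR (full_normal F)).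
Let sSn := subgroup_normal (itcomm_normal c nS (full_normal F)).

Let lift f : F := val (tmap f).
Let pi_lift f : pi (lift f) = tmap f. Proof. exact: qpi_val. Qed.

Let lift_mem f : Sn c (lift f).
Proof.
have [y Sy ey] := tmap_mem f; have /qpi_eq Ry : pi (lift f) = pi y by rewrite pi_lift.
have [_ SM _] := sSn; rewrite -[lift f](mulgVK y); apply: SM => //.
exact: (itcomm_sub RS).
Qed.

(** S_c/R_c is Z^P modulo the kernel K' of [tmap]. As K' contains K, the order of the tensor product
    is that of Z^P/K' times that of K'/K. *)
Lemma tensor_card : exists2 l, gcard_sec (Sn c) (Rn c) l &
  l %| gsec_order (fun _ : zfun P => True) K.
Proof.
have [n cn] := tensor_finite H1 H2 c.
pose K' (f : zfun P) := tmap f = 1.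
have sK' : subgroup K'.
  split=> [|g h eg eh|g eg]; first exact: zfun_hom1.
    by rewrite /K' tmapM eg eh mulg1.
  by rewrite /K' tmapV eg invg1.
have KK' f : K f -> K' f := @tmap_ker f.
have [m cm] := card_sec_sub sK' (fun f (_ : True) => I) KK' cn.
have [k ck] := @card_sec_sub (zfun P) _ K' _ _ _ sK (fun f _ => I) (fun f Kf => Kf) cn.
exists m; last first.
  by rewrite (sec_orderE sK (card_secM sT sK' (fun f _ => I) KK' cm ck)) dvdn_mulr.
apply: (card_sec_map (phi := lift) sRn _ _ _ cm) => [f _|f g _ _|y /tmap_onto[f ef]].
- exact: lift_mem.
- rewrite /K' tmapM tmapV -!pi_lift -gmulfV -gmulfM.
  exact: (qpi_eq1 (Rsub nR c)).
- by exists f => //; apply/(qpi_eq (Rsub nR c)); rewrite pi_lift.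
Qed.

Lemma tensor_exp x : Sn c x -> Rn c (x ^+ gsec_exp (fun _ : zfun P => True) K).
Proof.
have [n cn] := tensor_finite H1 H2 c.
move=> /tmap_onto[f ef]; set e := gsec_exp _ _.
have tX k : tmap f ^+ k = tmap (f ^+ k).
  elim: k => [|k IHk]; first by rewrite !expg0 [RHS]zfun_hom1.
  by rewrite !expgS IHk tmapM.
apply/(qpi_eq1 (Rsub nR c)); rewrite gmulfXn /= ef tX.
by apply: tmap_ker; apply: (sec_expP sT sK cn).
Qed.

Lemma tensor_gen : gen_by (Sn c) (Rn c) (gsec_d (fun _ : zfun P => True) K).
Proof.
have [n cn] := tensor_finite H1 H2 c.
have [g [_ gP]] := sec_d_genP cn; exists (fun i => lift (g i)); split=> [i|x].
  exact: lift_mem.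
move=> /tmap_onto[f ef]; set W := ggen _.
have sW : subgroup W by apply: gen_subgroup.
have [W1 WM WV] := sW.
have RW y : Rn c y -> W y by move=> Ry; apply: gen_in; left.
suff Wf : W (lift f).
  rewrite -[x](mulgVK (lift f)); apply: WM => //; apply: RW.
  by apply/(qpi_eq (Rsub nR c)); rewrite pi_lift.
have eqW y z : W z -> pi y = pi z -> W y.
  by move=> Wz /qpi_eq Ryz; rewrite -[y](mulgVK z); apply: WM => //; apply: RW.
have sWl : subgroup (fun f => W (lift f)).
  split=> [|f1 f2 W1' W2'|f1 W1'].
  - by apply: (eqW _ 1) => //; rewrite pi_lift gmulf1 [LHS]zfun_hom1.
  - by apply: (eqW _ (lift f1 * lift f2)); [apply: WM|rewrite pi_lift gmulfM /= !pi_lift tmapM].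
  - by apply: (eqW _ (lift f1)^-1); [apply: WV|rewrite pi_lift gmulfV /= !pi_lift tmapV].
apply: (gen_min sWl) (gP f I) => h [Kh|[i ->]].
  by apply: (eqW _ 1) => //; rewrite pi_lift gmulf1 tmap_ker.
by apply: gen_in; right; exists i.
Qed.

End TensorMap.

(** * Presentations of finite groups *)

(** A set-theoretic section of [h] on [D], multiplicative only modulo [N]: tensors are indexed by
    elements of finite groups, while commutators are formed in F. *)
Lemma section_lift (F : groupType) (D N : F -> Prop) (T : finGroupType) (H : {group T})
    (h : F -> T) :
  subgroup D ->
  (forall x, D x -> h x \in H) -> (forall x y, D x -> D y -> h (x * y) = h x * h y) ->
  (forall a, a \in H -> exists2 x, D x & h x = a) -> (forall x, D x -> h x = 1 -> N x) ->
  exists l : T -> F, [/\ forall a, a \in H -> D (l a),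
    forall a b, a \in H -> b \in H -> N (l (a * b) * (l a * l b)^-1) &
    forall s, D s -> exists2 a, a \in H & N (s * (l a)^-1)].
Proof.
move=> [D1 DM DV] hH hM hS hN.
have hE x y : D x -> D y -> h x = h y -> N (x * y^-1).
  move=> Dx Dy e; apply: hN; first exact/DM/DV.
  by apply: (mulIg (h y)); rewrite -hM ?mulgVK ?mul1g //; apply/DM/DV.
have lP a : exists x, a \in H -> D x /\ h x = a.
  by case: (boolP (a \in H)) => [/hS[x Dx hx]|_]; [exists x|exists 1].
have [l lE] := choice lP; exists l; split=> [a /lE[]//|a b aH bH|s Ds].
  have [Da ha] := lE _ aH; have [Db hb] := lE _ bH; have [Dab hab] := lE _ (groupM aH bH).
  by apply: hE => //; [apply: DM|rewrite hab hM // ha hb].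
exists (h s); first exact: hH.
by have [Dl hl] := lE _ (hH _ Ds); apply: hE.
Qed.

Section GroupHoms.
Variables (F F' : groupType) (e : F -> F').
Hypothesis eM : {morph e : x y / x * y}.
Implicit Types x y : F.

Lemma hom1 : e 1 = 1. Proof. by apply: (mulIg (e 1)); rewrite -eM !mul1g. Qed.
Lemma homV x : e x^-1 = (e x)^-1.
Proof. by apply: (mulIg (e x)); rewrite -eM !mulVg hom1. Qed.
Lemma homJ x y : e (x ^ y) = e x ^ e y.
Proof. by rewrite !conjgE !eM homV. Qed.
Lemma homR x y : e [~ x, y] = [~ e x, e y].
Proof. by rewrite !commgEl eM homV homJ. Qed.

End GroupHoms.

Section Presentation.
Variables (F : groupType) (gT : finGroupType) (G : {group gT}) (e : F -> gT).
Hypothesis eM : {morph e : x y / x * y}.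
Hypothesis eG : forall x, e x \in G.
Hypothesis eS : forall g, g \in G -> exists x, e x = g.
Implicit Types (x y : F) (A : {group gT}).

Let e1 := hom1 eM.
Let eV := homV eM.
Let eJ := homJ eM.
Let eR := homR eM.

Definition hker x := e x = 1.
Definition hpre A x := e x \in A.

Lemma hker_normal : normal_subgroup hker.
Proof.
split; [split; [exact: e1|move=> x y ex ey|move=> x ex]|move=> x y ex]; rewrite /hker.
- by rewrite eM ex ey mulg1.
- by rewrite eV ex invg1.
- by rewrite eJ ex conj1g.
Qed.

Lemma hpre_normal A : G \subset 'N(A) -> normal_subgroup (hpre A).
Proof.
move=> nA; split; [split; [|move=> x y ex ey|move=> x ex]|move=> x y ex]; rewrite /hpre.
- by rewrite e1 group1.
- by rewrite eM groupM.
- by rewrite eV groupV.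
- by rewrite eJ memJ_norm // (subsetP nA).
Qed.

Lemma hom_lcn n x : glcn n x -> e x \in 'L_n.+1(G).
Proof.
elim: n x => [|n IHn] x; first by rewrite lcn1.
have [sL _] := hpre_normal (lcn_norm n.+2 G).
apply: (commS_min sL) => y z /IHn Ly _; rewrite /hpre eR /= lcnSn.
exact: mem_commg.
Qed.

Lemma hom_lcn_lift n g : g \in 'L_n.+1(G) -> exists2 x, glcn n x & e x = g.
Proof.
elim: n g => [|n IHn] g; first by rewrite lcn1 => /eS[x ex]; exists x.
have [[l1 lM lV] _] := @glcn_normal F n.+1.
pose W := [set g | `[< exists2 x : F, glcn n.+1 x & e x = g >]].
have gW : group_set W.
  apply/group_setP; split=> [|g1 g2]; rewrite !inE.
    by apply/asboolP; exists 1; rewrite ?e1.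
  move=> /asboolP[x lx <-] /asboolP[y ly <-]; apply/asboolP.
  by exists (x * y); rewrite ?eM //; apply: lM.
suff /subsetP sLW : 'L_n.+2(G) \subset Group gW by move=> /sLW; rewrite inE => /asboolP.
rewrite lcnSn gen_subG; apply/subsetP => _ /imset2P[g1 g2 /IHn[x lx <-] /eS[y <-] ->].
by rewrite inE; apply/asboolP; exists [~ x, y]; rewrite ?eR //; apply: commS_mem.
Qed.

(** * The last lower central term, with t = n + 1: S lies over L_t(G) and Z over Z_{t-1}(G) *)

Section LastTerm.
Variable n : nat.
Hypothesis Ln2 : 'L_n.+2(G) = 1.
Notation R := hker.
Notation S := (hpre 'L_n.+1(G)).
Notation Z := (hpre 'Z_n(G)).
Notation Rn i := (gitcomm R gfull i).
Notation Sn i := (gitcomm S gfull i).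

Lemma last_pre_normal : normal_subgroup S.
Proof. exact/hpre_normal/lcn_norm. Qed.

Lemma ucn_pre_normal : normal_subgroup Z.
Proof. exact/hpre_normal/ucn_norm. Qed.

Lemma ker_sub_last x : R x -> S x.
Proof. by rewrite /hpre => ->; apply: group1. Qed.

Lemma last_central x y : S x -> R [~ x, y].
Proof.
move=> Sx; apply/eqP; rewrite eR -in_set1 -[[set 1]]Ln2 lcnSn.
exact: mem_commg.
Qed.

Lemma ucn_last : 'Z_n.+1(G) = G.
Proof. by apply/eqP; rewrite -ucn_lcnP Ln2. Qed.

(** Since gamma_{n+1}(F) maps onto L_{n+1}(G), S = gamma_{n+1}(F) R. Each further commutator splits
    by [ur, y] = [u, y]^r [r, y]. *)
Lemma last_itcomm_decomp i x : Sn i x ->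
  exists u r, [/\ glcn (n + i) u, Rn i r & x = u * r].
Proof.
have nR := hker_normal; elim: i x => [|i IHi] x.
  rewrite addn0 => /hom_lcn_lift[u lu eu]; exists u, (u^-1 * x); split=> //.
    by rewrite /= /hker eM eV eu mulVg.
  by rewrite mulVKg.
have [[R1 RM RV] RJ] := itcomm_normal i.+1 nR (full_normal F).
have [[l1 lM lV] lJ] := @glcn_normal F (n + i.+1).
have sP : subgroup (fun x => exists u r, [/\ glcn (n + i.+1) u, Rn i.+1 r & x = u * r]).
  split; first by exists 1, 1; rewrite mulg1.
    move=> _ _ [u [r [lu Rr ->]]] [v [s [lv Rs ->]]]; exists (u * v), (r ^ v * s).
    by split; [exact: lM|apply: RM => //; apply: RJ|rewrite conjgE !mulgA mulgK].
  move=> _ [u [r [lu Rr ->]]]; exists (u^-1), ((r^-1) ^ u^-1).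
  by split; [exact: lV|apply/RJ/RV|rewrite invgM conjgE invgK !mulgA mulVg mul1g].
apply: (commS_min sP) => _ y /IHi[u [r [lu Rr ->]]] _.
exists ([~ u, y] ^ r), [~ r, y]; split; last exact: commg_mull.
  by apply: lJ; rewrite addnS; apply: commS_mem.
exact: commS_mem.
Qed.

Lemma ucn_pre_itcomm k x : gitcomm Z gfull k x -> e x \in 'Z_(n - k)(G).
Proof.
elim: k x => [|k IHk] x; first by rewrite subn0.
have [sZ _] := hpre_normal (ucn_norm (n - k.+1) G).
apply: (commS_min sZ) => y g /IHk Zy _; rewrite /hpre eR.
(* From k = n on, the truncated difference stays 0, and y already maps into Z_0(G) = 1. *)
case: (ltnP k n) => [lt|le].
  by apply: (subsetP (ucn_comm _ _)); rewrite subnS prednK ?subn_gt0 // mem_commg.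
move: Zy; rewrite (eqP (_ : n - k == 0)%N) ?subn_eq0 // ucn0 => /set1P ->.
by rewrite comm1g group1.
Qed.

(** For u in gamma_{n+i+1}(F), [comm_lcn] puts [u, z] in [Z, _{n+i+1} F]. The first n commutators
    bring Z_n(G) down to 1, so [Z, _n F] lies in R and i + 1 commutators remain. *)
Lemma last_itcomm_ucn i x z : Sn i x -> Z z -> Rn i.+1 [~ x, z].
Proof.
have nR := hker_normal.
have [[R1 RM RV] RJ] := itcomm_normal i.+1 nR (full_normal F).
move=> /last_itcomm_decomp[u [r [lu Rr ->]]] Zz; rewrite commg_mull.
apply: RM; last exact: commS_mem.
apply: RJ; have := comm_lcn ucn_pre_normal lu Zz; rewrite -addnS itcommD.
apply: itcomm_sub => y /ucn_pre_itcomm; rewrite subnn ucn0.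
exact: set1P.
Qed.

Lemma last_abelian : abelian 'L_n.+1(G).
Proof.
apply/commG1P/trivgP; rewrite -Ln2 lcnSn commgS //.
exact: lcn_sub.
Qed.

Lemma quotient_ucn_abelian : abelian (G / 'Z_n(G)).
Proof.
apply: sub_der1_abelian; rewrite derg1 -{1}ucn_last.
exact: ucn_comm.
Qed.

(** The tensor product is built on B/B' even for abelian B; since B' = 1, passing to cosets loses
    nothing. *)
Let coset_ker (T : finGroupType) (A : {group T}) (x : T) :
  abelian A -> coset A^`(1) x = 1 -> x = 1.
Proof.
move/derG1P=> A1 cx; have nx : x \in 'N(A^`(1)) by rewrite A1 norm1 inE.
by have := coset_idr nx cx; rewrite /= A1 => /set1P.
Qed.

Let cosetM_abelian (T : finGroupType) (A : {group T}) (x y : T) :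
  abelian A -> coset A^`(1) (x * y) = coset A^`(1) x * coset A^`(1) y.
Proof. by move/derG1P=> A1; rewrite morphM // A1 norm1 inE. Qed.

Lemma last_lift : exists l : coset_of 'L_n.+1(G)^`(1) -> F,
  [/\ forall a, a \in 'L_n.+1(G) / 'L_n.+1(G)^`(1) -> S (l a),
    forall a b, a \in 'L_n.+1(G) / 'L_n.+1(G)^`(1) -> b \in 'L_n.+1(G) / 'L_n.+1(G)^`(1) ->
      R (l (a * b) * (l a * l b)^-1) &
    forall s, S s -> exists2 a, a \in 'L_n.+1(G) / 'L_n.+1(G)^`(1) & R (s * (l a)^-1)].
Proof.
apply: (section_lift (h := fun x => coset 'L_n.+1(G)^`(1) (e x))).
- by case: last_pre_normal.
- by move=> x Sx; apply: mem_quotient.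
- by move=> x y _ _; rewrite eM cosetM_abelian //; apply: last_abelian.
- move=> _ /morphimP[g _ Lg ->]; have [x ex] := eS (subsetP (lcn_sub _ _) g Lg).
  by exists x; rewrite ?ex // /hpre ex.
- by move=> x _; apply: coset_ker; apply: last_abelian.
Qed.

Notation A := (G / 'Z_n(G)).

Lemma ucn_lift : exists l : coset_of A^`(1) -> F,
  [/\ forall a, a \in A / A^`(1) -> True,
    forall a b, a \in A / A^`(1) -> b \in A / A^`(1) -> Z (l (a * b) * (l a * l b)^-1) &
    forall s : F, True -> exists2 a, a \in A / A^`(1) & Z (s * (l a)^-1)].
Proof.
have nZ x : e x \in 'N('Z_n(G)) by apply: (subsetP (ucn_norm n G)).
apply: (@section_lift F gfull Z _ (G / 'Z_n(G) / (G / 'Z_n(G))^`(1))%G (fun x => coset A^`(1) (coset 'Z_n(G) (e x)))) => //.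
- by move=> x _; do 2!apply: mem_quotient.
- move=> x y _ _; rewrite eM morphM // cosetM_abelian //.
  exact: quotient_ucn_abelian.
- move=> _ /morphimP[g _ /morphimP[h _ Gh ->] ->]; have [x ex] := eS Gh.
  by exists x; rewrite ?ex.
- move=> x _ /(coset_ker quotient_ucn_abelian) cx.
  exact: coset_idr (nZ x) cx.
Qed.

Section Tensor.
Variable c : nat.
Notation L := ('L_n.+1(G))%G.
Notation AG := (G / 'Z_n(G))%G.

Lemma last_card : exists2 l, gcard_sec (Sn c) (Rn c) l & l %| tens_order L AG c.
Proof.
have [l1 [l1S l1M l1P]] := last_lift; have [l2 [_ l2M l2P]] := ucn_lift.
exact: (tensor_card (H1 := (L / L^`(1))%G) (H2 := (AG / AG^`(1))%G) hker_normal last_pre_normal ker_sub_last last_central last_itcomm_ucn c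
  l1S l1M l1P l2M (fun g => l2P g I)).
Qed.

Lemma last_exp x : Sn c x -> Rn c (x ^+ tens_exp L AG c).
Proof.
have [l1 [l1S l1M l1P]] := last_lift; have [l2 [_ l2M l2P]] := ucn_lift.
exact: (tensor_exp (H1 := (L / L^`(1))%G) (H2 := (AG / AG^`(1))%G) hker_normal last_pre_normal ker_sub_last last_central last_itcomm_ucn
  l1S l1M l1P l2M (fun g => l2P g I)).
Qed.

Lemma last_gen : gen_by (Sn c) (Rn c) (tens_d L AG c).
Proof.
have [l1 [l1S l1M l1P]] := last_lift; have [l2 [_ l2M l2P]] := ucn_lift.
exact: (tensor_gen (H1 := (L / L^`(1))%G) (H2 := (AG / AG^`(1))%G) hker_normal last_pre_normal ker_sub_last last_central last_itcomm_ucn c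
  l1S l1M l1P l2M (fun g => l2P g I)).
Qed.

End Tensor.
End LastTerm.
End Presentation.

(** * The c-nilpotent multiplier *)

(** [multA] and [multN] for any F and R, to which they are convertible: one group F can then serve
    both G, with R, and G/L_t(G), with S. *)
Definition baer_num (F : groupType) (R : F -> Prop) c x := R x /\ glcn c x.
Definition baer_den (F : groupType) (R : F -> Prop) c := gitcomm R gfull c.

Section Multiplier.
Variables (F : groupType) (gT : finGroupType) (G : {group gT}) (e : F -> gT).
Hypothesis eM : {morph e : x y / x * y}.
Hypothesis eG : forall x, e x \in G.
Hypothesis eS : forall g, g \in G -> exists x, e x = g.
Variables (n c : nat).
Hypothesis Ln2 : 'L_n.+2(G) = 1.
Hypothesis c_gt0 : 0 < c.
Notation R := (hker e).
Notation S := (hpre e 'L_n.+1(G)).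
Notation AR := (baer_num R c).
Notation AS := (baer_num S c).
Notation NR := (baer_den R c).
Notation NS := (baer_den S c).
Notation L := ('L_n.+1(G))%G.
Notation AG := (G / 'Z_n(G))%G.

Let nR : normal_subgroup R := hker_normal eM.
Let nS : normal_subgroup S := last_pre_normal eM eG n.
Let sNR : subgroup NR := subgroup_normal (itcomm_normal c nR (full_normal F)).
Let sNS : subgroup NS := subgroup_normal (itcomm_normal c nS (full_normal F)).
Let slc : subgroup (glcn c : F -> Prop) := subgroup_normal (@glcn_normal F c).
Let sAR : subgroup AR := subI (subgroup_normal nR) slc.
Let sAS : subgroup AS := subI (subgroup_normal nS) slc.

Let ARS x : AR x -> AS x.
Proof. by case=> Rx lx; split=> //; apply: ker_sub_last. Qed.

Let NRS x : NR x -> NS x.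
Proof. by apply: itcomm_sub => y; apply: ker_sub_last. Qed.

(** Here c >= 1 enters: the first commutator with F already takes S into R, and the others stay
    there because R is normal. *)
Let NSAR x : NS x -> AR x.
Proof.
move=> NSx; split; last by apply: itcomm_sub NSx.
move: NSx; rewrite /baer_den -(prednK c_gt0) itcommS => NSx.
have {NSx} : gitcomm R gfull c.-1 x.
  apply: itcomm_sub NSx => y; apply: commS_min => [|u v Su _]; first by case: nR.
  exact: (last_central eM eG Ln2).
by rewrite -[c.-1]add0n; apply: (@itcomm_subD _ _ 0).
Qed.

(** A lift in gamma_{c+1}(F) of an element of the intersection is automatically in S, a full
    preimage. The intersection is whichever of the two terms has the larger index, so both cases of
    the order bound are covered at once. *)
Lemma baer_num_quotient : gcard_sec AS AR #|'L_n.+1(G) :&: 'L_c.+1(G)|.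
Proof.
have -> : 'L_n.+1(G) :&: 'L_c.+1(G) = [set i | `[< exists2 x, AS x & e x = i >]].
  apply/setP=> g; rewrite !inE; apply/andP/asboolP => [[gn]|[x [Sx lx] <-]]; last first.
    by split=> //; apply: (hom_lcn eM eG).
  move=> /(hom_lcn_lift eM eS)[x lx ex]; exists x => //; split=> //.
  by rewrite /hpre ex.
apply: card_sec_inv => x y [Sx lx] [Sy ly]; split=> [[exy _]|exy].
  by apply: (mulIg (e y^-1)); rewrite -!eM exy mulgV (hom1 eM).
split; first by rewrite /hker eM (homV eM) exy mulgV.
by apply: sub_div.
Qed.

Lemma baer_card q : gcard_sec AS NS q ->
  exists m, gcard_sec AR NR m /\
    #|'L_n.+1(G) :&: 'L_c.+1(G)| * m %| q * tens_order L AG c.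
Proof.
move=> cq; have [l cl dl] := last_card eM eG eS Ln2 c.
have cql := card_secM sAS sNS (fun x NSx => ARS (NSAR NSx)) NRS cq cl.
have [m cm] := card_sec_sub sNR ARS (fun x h => h) cql.
have cgm := card_secM sAS sAR ARS (fun x NRx => NSAR (NRS NRx)) baer_num_quotient cm.
by exists m; split=> //; rewrite (card_sec_uniq sNR cgm cql) dvdn_mul.
Qed.

Lemma baer_exp k : (forall x, AS x -> NS (x ^+ k)) ->
  forall x, AR x -> NR (x ^+ (k * tens_exp L AG c)).
Proof.
move=> kP x /ARS/kP NSx; rewrite expgnA.
exact: (last_exp eM eG eS Ln2).
Qed.

(** The section (S n gamma_{c+1}(F))/S_c is abelian because [gamma_{c+1}(F), S] lies in S_{c+1}, so
    [gen_by_sub] bounds its subgroup (R n gamma_{c+1}(F))/S_c; the generators of S_c/R_c are then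
    added. *)
Lemma baer_gen q k : gcard_sec AS NS q -> gen_by AS NS k ->
  gen_by AR NR (k + tens_d L AG c).
Proof.
move=> cq gk; apply: (gen_byD NSAR); last exact: (last_gen eM eG eS Ln2).
apply: (gen_by_sub sAS sAR sNS cq _ ARS NSAR gk) => x y [_ lx] [Sy _].
by apply: itcommS_sub => //; apply: comm_lcn.
Qed.

End Multiplier.

(** * The quotient G/H presented by the same group F *)

Section QuotientPresentation.
Variables (F : groupType) (gT : finGroupType) (G H : {group gT}) (e : F -> gT).
Hypothesis eM : {morph e : x y / x * y}.
Hypothesis eG : forall x, e x \in G.
Hypothesis eS : forall g, g \in G -> exists x, e x = g.
Hypothesis nHG : H <| G.

Let nH x : e x \in 'N(H).
Proof. exact: subsetP (normal_norm nHG) _ (eG x). Qed.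

Lemma coset_homM : {morph (fun x => coset H (e x)) : x y / x * y}.
Proof. by move=> x y; rewrite eM morphM. Qed.

Lemma coset_hom_in x : coset H (e x) \in G / H.
Proof. exact: mem_quotient. Qed.

Lemma coset_hom_onto a : a \in G / H -> exists x, coset H (e x) = a.
Proof. by case/morphimP=> g _ /eS[x <-] ->; exists x. Qed.

Lemma coset_hom_ker : hker (fun x => coset H (e x)) = hpre e H.
Proof.
apply/funext => x; apply/propext; split=> [/(coset_idr (nH x))//|].
exact: coset_id.
Qed.

End QuotientPresentation.

Lemma quotient_lcn (gT : finGroupType) (G : {group gT}) n :
  'L_n.+1(G / 'L_n.+1(G)) = 1.
Proof.
by have := morphim_lcn (coset_morphism 'L_n.+1(G)) n.+1 (lcn_norm n.+1 G); rewrite /= => <-; apply: trivg_quotient.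
Qed.

(* [F] is arbitrary so that the induction can pass from G to G/L_{n+1}(G) without
   changing [F]. *)
Lemma baer_finite (F : groupType) c n (gT : finGroupType) (G : {group gT}) (e : F -> gT) :
  0 < c -> {morph e : x y / x * y} -> (forall x, e x \in G) ->
  (forall g, g \in G -> exists x, e x = g) -> 'L_n.+1(G) = 1 ->
  exists q, gcard_sec (baer_num (hker e) c) (baer_den (hker e) c) q.
Proof.
move=> c0; elim: n gT G e => [|n IHn] gT G e eM eG eS Ln.
  (* G is trivial, so R = F, and numerator and denominator are both gamma_{c+1}(F). *)
  have -> : hker e = fun _ => True.
    apply/funext => x; apply/propext; split=> // _; apply/set1P.
    by rewrite -[[set 1]]Ln; apply: eG.
  have [[l1 lM lV] _] := @glcn_normal F c.
  apply: (@card_sec_cover _ unit _ _ (fun _ => 1)); first by case: (@glcn_normal F c).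
  by move=> x [_ lx]; exists tt; rewrite invg1 mulg1.
have nL := lcn_normal n.+1 G.
have [q] := IHn _ (G / 'L_n.+1(G))%G _ (coset_homM eM eG nL) (coset_hom_in 'L_n.+1(G) eG)
  (coset_hom_onto (H := 'L_n.+1(G)%G) eS) (quotient_lcn G n).
rewrite (coset_hom_ker eG nL) => cq.
by have [m [cm _]] := baer_card eM eG eS Ln c0 cq; exists m.
Qed.

(** * Free groups *)

Section FreeGroup.
Variable X : eqType.
Notation letter := (X * bool)%type.
Implicit Types (a b : letter) (s st v : seq letter) (u w : FG X).

(** If the top of [st] cancels [b], it is the letter [a] itself, and as [st] is reduced, pushing [a]
    back causes no further cancellation. *)
Lemma fstepK st a b : reducedb st -> canc a b -> fstep (fstep st b) a = st.
Proof.
case: a b => [x i] [y j]; rewrite /canc /= => rst /andP[/eqP<- ij].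
case: st rst => [_|[z k] st rst] /=; first by rewrite /canc /= eqxx ij.
rewrite {1}/canc /=; case: ifP => [/andP[/eqP ez jk]|_] /=; last by rewrite /canc /= eqxx ij.
have -> : (z, k) = (x, i) by rewrite -ez; congr pair; case: i j k ij jk {rst} => [] [] [].
have ik : k = i by case: i j k ij jk {rst} => [] [] [].
by case: st rst => [|d st] //= /andP[]; rewrite -ez ik => /negPf->.
Qed.

Lemma foldl_fstep_rev st v a : reducedb st ->
  foldl (@fstep X) st (rev (fstep v a)) = fstep (foldl (@fstep X) st (rev v)) a.
Proof.
move=> rst; case: v => [|b v] //=; case: ifP => cab.
  by rewrite rev_cons foldl_rcons fstepK //; apply: foldl_fstep_red.
by rewrite rev_cons foldl_rcons.
Qed.

(** Appending a word gives the same stack whether or not the word was reduced beforehand, which is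
    what associativity needs. *)
Lemma foldl_fstep_push st v s : reducedb st ->
  foldl (@fstep X) st (rev (foldl (@fstep X) v s)) =
  foldl (@fstep X) (foldl (@fstep X) st (rev v)) s.
Proof.
by move=> rst; elim: s v => //= a s IHs v; rewrite IHs foldl_fstep_rev.
Qed.

Lemma foldl_fstep_reduced v : reducedb v -> foldl (@fstep X) [::] (rev v) = v.
Proof.
elim: v => //= a v IHv rv; rewrite rev_cons foldl_rcons IHv; last first.
  by case: v rv {IHv} => //= b v /andP[].
by case: v rv {IHv} => //= b v /andP[/negPf->].
Qed.

Let flip a : letter := (a.1, ~~ a.2).

Let foldl_flipK st s : reducedb st ->
  foldl (@fstep X) (foldl (@fstep X) st (map flip s)) (rev s) = st.
Proof.
elim: s st => //= a s IHs st rst; rewrite rev_cons foldl_rcons IHs ?fstep_red //.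
by rewrite fstepK // /canc /= eqxx; case: a.2.
Qed.

Let foldl_flipV s : foldl (@fstep X) s (map flip s) = [::].
Proof. by elim: s => //= a s IHs; rewrite /canc /= eqxx; case: a.2. Qed.

Lemma fg_mulA : associative (@fg_mul X).
Proof.
move=> [u ru] [v rv] [w rw]; apply: val_inj => /=.
by rewrite foldl_fstep_push.
Qed.

Lemma fg_mul1 : left_id (fg_one X) (@fg_mul X).
Proof. by move=> [u ru]; apply: val_inj => /=; apply: foldl_fstep_reduced. Qed.

Lemma fg_mulr1 : right_id (fg_one X) (@fg_mul X).
Proof. by move=> [u ru]; apply: val_inj. Qed.

Lemma fg_mulV : left_inverse (fg_one X) (@fg_inv X) (@fg_mul X).
Proof. by move=> [u ru]; apply: val_inj => /=; apply: foldl_flipK. Qed.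

Lemma fg_mulrV : right_inverse (fg_one X) (@fg_inv X) (@fg_mul X).
Proof.
move=> [u ru]; apply: val_inj => /=.
by rewrite foldl_fstep_push //= foldl_flipV.
Qed.

HB.instance Definition _ := gen_eqMixin (FG X).
HB.instance Definition _ := gen_choiceMixin (FG X).
HB.instance Definition _ := isGroup.Build (FG X) fg_mulA fg_mul1 fg_mulr1 fg_mulV fg_mulrV.

Definition fgen (x : X) : FG X := exist _ [:: (x, false)] isT.

Lemma fg_ind (P : FG X -> Prop) : subgroup P -> (forall x, P (fgen x)) -> forall u, P u.
Proof.
move=> [P1 PM PV] Pg [s rs]; elim: s rs => [|[x i] s IHs] rs.
  by have -> : exist _ [::] rs = 1 :> FG X by apply: val_inj.
have rs' : reducedb s by case: s rs {IHs} => //= b s /andP[].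
pose g : FG X := if i then (fgen x)^-1 else fgen x.
have -> : exist _ ((x, i) :: s) rs = (exist _ s rs' : FG X) * g.
  apply: val_inj; rewrite /g.
  by case: i s rs rs' {IHs g} => [] [|b s] //= /andP[/negPf->].
by apply: PM; [apply: IHs|rewrite /g; case: i {rs g}; [apply: PV|]].
Qed.

Section Eval.
Variables (H : groupType) (f : X -> H).
Let ev (a : letter) : H := if a.2 then (f a.1)^-1 else f a.1.
Let wev s : H := foldr (fun a acc => ev a * acc) 1 s.

Definition fg_hom u : H := wev (rev (proj1_sig u)).

Let wev_cat s1 s2 : wev (s1 ++ s2) = wev s1 * wev s2.
Proof. by elim: s1 => [|a s1 IHs] /=; rewrite ?mul1g // IHs mulgA. Qed.

Let wev_fstep st a : wev (rev (fstep st a)) = wev (rev st) * ev a.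
Proof.
case: st => [|b st] /=; first by rewrite mul1g mulg1.
case: ifP => cab; rewrite rev_cons -cats1 !wev_cat /= mulg1 //.
rewrite -mulgA; suff -> : ev b * ev a = 1 by rewrite mulg1.
case: a b cab => [x i] [y j]; rewrite /canc /ev /= => /andP[/eqP->].
by case: i j => [] [] // _; rewrite ?mulgV ?mulVg.
Qed.

Let wev_foldl st s : wev (rev (foldl (@fstep X) st s)) = wev (rev st) * wev s.
Proof.
by elim: s st => [|a s IHs] st /=; rewrite ?mulg1 // IHs wev_fstep mulgA.
Qed.

Lemma fg_homM : {morph fg_hom : u w / u * w}.
Proof. by move=> u w; rewrite /fg_hom [LHS]wev_foldl. Qed.

Lemma fg_hom_gen x : fg_hom (fgen x) = f x.
Proof. by rewrite /fg_hom /= mulg1. Qed.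

End Eval.
End FreeGroup.

(** Projectivity of free groups: lift the images of the generators and compare the two maps on
    generators. *)
Lemma free_lift (X : eqType) (F : groupType) (T : finGroupType) (e1 : FG X -> T) (e2 : F -> T) :
  {morph e1 : x y / x * y} -> {morph e2 : x y / x * y} ->
  (forall w, exists y, e2 y = e1 w) ->
  exists2 phi : FG X -> F, {morph phi : x y / x * y} & forall w, e2 (phi w) = e1 w.
Proof.
move=> e1M e2M eS; have [l lE] := choice (fun x => eS (fgen x)).
have hM := fg_homM l; exists (fg_hom l) => //; apply: fg_ind => [|x]; last first.
  by rewrite fg_hom_gen.
split=> [|x y ex ey|x ex].
- by rewrite (hom1 hM) (hom1 e1M) (hom1 e2M).
- by rewrite hM e1M e2M ex ey.
- by rewrite (homV hM) (homV e1M) (homV e2M) ex.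
Qed.

Lemma fg_evalM (gT : finGroupType) (G : {group gT}) :
  {morph @fg_eval gT G : x y / x * y}.
Proof. exact: (fg_homM (fun x : genG G => val x)). Qed.

Lemma fg_eval_in (gT : finGroupType) (G : {group gT}) (w : FG (genG G)) : fg_eval w \in G.
Proof.
have eM := @fg_evalM gT G.
apply: (fg_ind (P := fun w => fg_eval w \in G)) => [|x].
  split=> [|x y xG yG|x xG]; first by rewrite (hom1 eM) group1.
    by rewrite eM groupM.
  by rewrite (homV eM) groupV.
by rewrite /fg_eval /= mulg1; case: x.
Qed.

Lemma fg_eval_onto (gT : finGroupType) (G : {group gT}) g :
  g \in G -> exists w : FG (genG G), fg_eval w = g.
Proof.
by move=> gG; exists (fgen (exist _ g gG : genG G)); rewrite /fg_eval /= mulg1.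
Qed.

(** * Independence of the presentation *)

Section LiftOfIdentity.
Variables (F : groupType) (R : F -> Prop) (theta : F -> F).
Hypotheses (nR : normal_subgroup R) (tM : {morph theta : x y / x * y}).
Hypothesis tR : forall x, R (theta x * x^-1).

(** With theta x = rx and theta y = sy, where r is in R_i and s in R, the commutator [rx, sy]
    reduces modulo R_{i+1} to [x, y]: r contributes a conjugate of [r, sy], and s a conjugate of
    [x, s], which is in R_{i+1} by [comm_lcn] as x is in gamma_{i+1}(F). *)
Lemma lift_id_lcn i u : glcn i u -> gitcomm R gfull i (theta u * u^-1).
Proof.
elim: i u => [|i IHi] u; first by move=> _; apply: tR.
pose pi := qpi (Rsub nR i.+1).
have eqP' x : gitcomm R gfull i.+1 (theta x * x^-1) <-> pi (theta x) = pi x.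
  by split=> /(qpi_eq (Rsub nR i.+1)).
have sP : subgroup (fun x => gitcomm R gfull i.+1 (theta x * x^-1)).
  split=> [|x y /eqP' ex /eqP' ey|x /eqP' ex]; apply/eqP'.
  - by rewrite (hom1 tM).
  - by rewrite tM /pi !gmulfM; congr (_ * _).
  - by rewrite (homV tM) /pi !gmulfV; congr (_^-1).
apply: (commS_min sP) => x y lx _; apply/eqP'; rewrite (homR tM).
have Rx := IHi x lx; have Ry := tR y.
rewrite -[theta x](mulgVK x) -[theta y](mulgVK y).
move: (theta x * x^-1) (theta y * y^-1) Rx Ry => r s Rr Rs.
have p1 z : gitcomm R gfull i.+1 z -> pi z = 1 by move=> Rz; apply/qpi_eq1.
have [_ RJ] := itcomm_normal i.+1 nR (full_normal F).
have pM' y1 y2 : pi (y1 * y2) = pi y1 * pi y2 by rewrite /pi gmulfM.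
rewrite commg_mull pM' (p1 (_ ^ _)) ?mul1g; last by apply: RJ; apply: commS_mem.
rewrite commg_mulr pM' (p1 (_ ^ _)) ?mulg1 //.
by apply: RJ; apply: comm_lcn.
Qed.

End LiftOfIdentity.

Section MorphSections.
Variables (F1 F2 : groupType) (phi : F1 -> F2) (R1 : F1 -> Prop) (R2 : F2 -> Prop).
Hypotheses (phiM : {morph phi : x y / x * y}) (phiR : forall x, R1 x -> R2 (phi x)).

Lemma morph_itcomm (U1 V1 : F1 -> Prop) (U2 V2 : F2 -> Prop) n x :
  (forall y, U1 y -> U2 (phi y)) -> (forall y, V1 y -> V2 (phi y)) ->
  gitcomm U1 V1 n x -> gitcomm U2 V2 n (phi x).
Proof.
move=> hU hV; elim: n x => [|n IHn] x /=; first exact: hU.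
have [g1 gM gV] := gen_subgroup (fun z => exists x y, gitcomm U2 V2 n x /\ V2 y /\ z = gcomm *%g (@inv F2) x y).
have sP : subgroup (fun x => gcommS (gitcomm U2 V2 n) V2 (phi x)).
  split=> [|y z hy hz|y hy].
  - by rewrite (hom1 phiM).
  - by rewrite phiM; apply: gM.
  - by rewrite (homV phiM); apply: gV.
apply: (commS_min sP) => y z /IHn Uy /hV Vz.
by rewrite (homR phiM); apply: commS_mem.
Qed.

Lemma morph_baer_num c x : baer_num R1 c x -> baer_num R2 c (phi x).
Proof. by case=> Rx lx; split; [apply: phiR|apply: morph_itcomm lx]. Qed.

Lemma morph_baer_den c x : baer_den R1 c x -> baer_den R2 c (phi x).
Proof. exact: morph_itcomm. Qed.

End MorphSections.

Section Independence.
Variables (F1 F2 : groupType) (R1 : F1 -> Prop) (R2 : F2 -> Prop) (c : nat).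
Hypotheses (nR1 : normal_subgroup R1) (nR2 : normal_subgroup R2).
Variables (phi : F1 -> F2) (psi : F2 -> F1).
Hypotheses (phiM : {morph phi : x y / x * y}) (psiM : {morph psi : x y / x * y}).
Hypotheses (phiR : forall x, R1 x -> R2 (phi x)) (psiR : forall x, R2 x -> R1 (psi x)).
Hypotheses (psi_phi : forall x, R1 (psi (phi x) * x^-1))
           (phi_psi : forall x, R2 (phi (psi x) * x^-1)).
Notation A1 := (baer_num R1 c).
Notation A2 := (baer_num R2 c).
Notation N1 := (baer_den R1 c).
Notation N2 := (baer_den R2 c).

Let sN1 : subgroup N1 := subgroup_normal (itcomm_normal c nR1 (full_normal F1)).
Let sN2 : subgroup N2 := subgroup_normal (itcomm_normal c nR2 (full_normal F2)).

(** The maps are inverse to each other only modulo [R1] and [R2]; on numerators [lift_id_lcn]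
    sharpens this to the denominators. *)
Let psi_phi_num x : A1 x -> N1 (psi (phi x) * x^-1).
Proof.
case=> _; apply: (lift_id_lcn nR1 (theta := psi \o phi)) => // y z /=.
by rewrite phiM psiM.
Qed.

Let phi_psi_num x : A2 x -> N2 (phi (psi x) * x^-1).
Proof.
case=> _; apply: (lift_id_lcn nR2 (theta := phi \o psi)) => // y z /=.
by rewrite psiM phiM.
Qed.

Let psi_phi_den x : A1 x -> N1 (psi (phi x)) -> N1 x.
Proof.
move=> /psi_phi_num Nx Npx; have [_ _ NV] := sN1.
by rewrite -[x]invgK; apply: NV; apply: sub_mull Npx Nx.
Qed.

Lemma baer_card_indep q : gcard_sec A1 N1 q -> gcard_sec A2 N2 q.
Proof.
have [[sl1 slM slV] _] := @glcn_normal F1 c.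
have [[r1 rM rV] _] := nR1.
apply: (card_sec_map (phi := phi) sN2) => [x|x y [Rx lx] [Ry ly]|y Ay].
- exact: morph_baer_num.
- rewrite -(homV phiM) -phiM; split; first exact: morph_baer_den.
  move=> /(morph_baer_den psiM psiR); apply: psi_phi_den.
  by split; [apply: rM|apply: slM] => //; [apply: rV|apply: slV].
exists (psi y); first exact: morph_baer_num Ay.
by apply: coset_sym => //; apply: phi_psi_num.
Qed.

Lemma baer_exp_indep k : (forall x, A2 x -> N2 (x ^+ k)) -> forall x, A1 x -> N1 (x ^+ k).
Proof.
move=> kP x Ax.
have phiX n : phi (x ^+ n) = phi x ^+ n.
  by elim: n => [|n IHn]; rewrite ?expg0 ?(hom1 phiM) // !expgS phiM IHn.
have [sl _] := @glcn_normal F1 c; have [sR _] := nR1.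
apply: psi_phi_den; first by case: Ax => Rx lx; split; apply: sub_expg.
apply: (morph_baer_den psiM psiR); rewrite phiX; apply: kP.
exact: morph_baer_num Ax.
Qed.

Lemma baer_gen_indep k : gen_by A2 N2 k -> gen_by A1 N1 k.
Proof.
move=> [f [Af fP]]; exists (psi \o f); split=> [i|x Ax].
  exact: morph_baer_num (Af i).
set W := ggen _; have sW : subgroup W by apply: gen_subgroup.
have [W1 WM WV] := sW.
have NW y : N1 y -> W y by move=> Ny; apply: gen_in; left.
have Wpx : W (psi (phi x)).
  have sP : subgroup (fun y => W (psi y)).
    split=> [|y z Wy Wz|y Wy]; rewrite ?(hom1 psiM) ?(homV psiM) ?psiM //.
      exact: WM.
    exact: WV.
  apply: (gen_min sP) (fP _ (morph_baer_num phiM phiR Ax)) => y [Ny|[i ->]].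
    exact/NW/(morph_baer_den psiM psiR).
  by apply: gen_in; right; exists i.
rewrite -[x]mul1g -(mulVg (psi (phi x) * x^-1)) -mulgA mulgVK.
by apply: WM => //; apply: WV; apply: NW; apply: psi_phi_num.
Qed.

End Independence.

(** * Comparison with the multiplier of the quotient, and the bounds *)

Section Main.
Variables (gT : finGroupType) (G : {group gT}) (c n : nat).
Hypotheses (c_gt0 : 0 < c) (Ln2 : 'L_n.+2(G) = 1).
Notation L := ('L_n.+1(G))%G.
Notation Q := (G / 'L_n.+1(G))%G.
Notation F := (FG (genG G)).
Notation FQ := (FG (genG Q)).
Notation R := (hker (@fg_eval gT G) : F -> Prop).
Notation S := (hpre (@fg_eval gT G) L : F -> Prop).
Notation RQ := (hker (@fg_eval _ Q) : FQ -> Prop).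

Let eM := @fg_evalM gT G.
Let eG := @fg_eval_in gT G.
Let eS := @fg_eval_onto gT G.
Let qM := @fg_evalM _ Q.
Let nL : L <| G := lcn_normal n.+1 G.
Let pM := coset_homM eM eG nL.
Let pQ := coset_hom_in L eG.
Let pS := coset_hom_onto (H := L) eS.

(** F with kernel S and FQ with kernel RQ both present G/L; each free group lifts its map to G/L
    through the other. *)
Lemma quotient_lifts : exists phi : F -> FQ, exists psi : FQ -> F,
  [/\ {morph phi : x y / x * y}, {morph psi : x y / x * y},
      forall x, S x -> RQ (phi x), forall x, RQ x -> S (psi x) &
      (forall x, S (psi (phi x) * x^-1)) /\ (forall x, RQ (phi (psi x) * x^-1))].
Proof.
have [phi phiM phiE] := free_lift pM qM (fun w => fg_eval_onto (pQ w)).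
have [psi psiM psiE] := free_lift qM pM (fun w => pS (fg_eval_in w)).
have SE x : S x = hker (fun x => coset L (fg_eval x)) x by rewrite (coset_hom_ker eG nL).
exists phi, psi; split=> //.
- by move=> x; rewrite SE /hker phiE.
- by move=> x; rewrite SE /hker psiE.
split=> x; rewrite ?SE /hker.
  by rewrite pM (homV pM) psiE phiE mulgV.
by rewrite qM (homV qM) phiE psiE mulgV.
Qed.

Let nR := hker_normal eM.
Let nS := last_pre_normal eM eG n.
Let nRQ := hker_normal qM.

Let den_sub (E : groupType) (P : E -> Prop) : normal_subgroup P -> subgroup (baer_den P c).
Proof. by move=> nP; apply/subgroup_normal/itcomm_normal. Qed.
Let num_sub (E : groupType) (P : E -> Prop) : normal_subgroup P -> subgroup (baer_num P c).
Proof. by move=> nP; apply: subI; apply: subgroup_normal => //; apply: glcn_normal. Qed.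

Lemma mult_bounds :
  [/\ #|'L_n.+1(G) :&: 'L_c.+1(G)| * mult_order c G %|
        mult_order c Q * tens_order L (G / 'Z_n(G))%G c,
      mult_exp c G %| mult_exp c Q * tens_exp L (G / 'Z_n(G))%G c
    & mult_d c G <= mult_d c Q + tens_d L (G / 'Z_n(G))%G c].
Proof.
have [phi [psi [phiM psiM phiR psiR [psi_phi phi_psi]]]] := quotient_lifts.
have [q cQ] := baer_finite c_gt0 qM (@fg_eval_in _ Q) (@fg_eval_onto _ Q) (quotient_lcn G n).
have cS := baer_card_indep nRQ nS psiM phiM psiR phiR phi_psi psi_phi cQ.
have [m [cR dm]] := baer_card eM eG eS Ln2 c_gt0 cS.
have qE : mult_order c Q = q := sec_orderE (den_sub nRQ) cQ.
have mE : mult_order c G = m := sec_orderE (den_sub nR) cR.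
split; first by rewrite qE mE.
  apply: (sec_exp_dvd (num_sub nR) (den_sub nR) cR).
  apply: (baer_exp eM eG eS Ln2).
  apply: (baer_exp_indep nS phiM psiM phiR psiR psi_phi).
  exact: (sec_expP (num_sub nRQ) (den_sub nRQ) cQ).
apply: sec_d_le; apply: (baer_gen eM eG eS Ln2 c_gt0 cS).
apply: (baer_gen_indep nS phiM psiM phiR psiR psi_phi).
exact: (sec_d_genP cQ).
Qed.

End Main.

Local Close Scope group_scope.

Theorem theoremC (gT : finGroupType) (G : {group gT}) (c : nat) :
  1 <= c -> nilpotent G -> 2 <= nil_class G ->
  let t := nil_class G in
  let Q := (G / 'L_t(G))%G in
  let tO := tens_order ('L_t(G))%G (G / 'Z_t.-1(G))%G c in
  let tE := tens_exp ('L_t(G))%G (G / 'Z_t.-1(G))%G c in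
  let tD := tens_d ('L_t(G))%G (G / 'Z_t.-1(G))%G c in
  [/\ c.+1 <= t -> #|('L_t(G))%g| * mult_order c G %| mult_order c Q * tO,
      t < c.+1 -> #|('L_c.+1(G))%g| * mult_order c G %| mult_order c Q * tO,
      mult_exp c G %| mult_exp c Q * tE
    & mult_d c G <= mult_d c Q + tD].
Proof.
move=> c1 nilG; have := lcn_nil_classP (nil_class G) nilG; rewrite leqnn.
case: (nil_class G) => [|n] // /elimT/(_ isT) Ln2 _ /=.
have [hO hE hD] := mult_bounds c1 Ln2.
split=> // le.
  by move: hO; rewrite (setIidPl (lcn_sub_leq G le)).
by move: hO; rewrite (setIidPr (lcn_sub_leq G (ltnW le))).
Qed.
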